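(* Let $d\ge 1$ be an integer and $\lambda=(d-1)/2$. The family $\{\mathrm{AG}_d(\eta,\rho):\eta\in\mathbb{S}_d,\ \rho>0\}$ of angular Gaussian distributions has a unique discrete mixture representation with mixing base $\mathrm{SBeta}_d(\eta,1,n+1)$, $n\in\mathbb{N}_0$. This representation is given by $$\mathrm{AG}_d(\eta,\rho)=\sum_{n=0}^\infty \mathrm{dpc}(n\,|\,\lambda+1,\rho)\,\mathrm{SBeta}_d(\eta,1,n+1).$$
   Context: $\mathbb{S}_d=\{x\in\mathbb{R}^{d+1}:\|x\|=1\}$ with Borel $\sigma$-field and uniform distribution $\mathrm{unif}(\mathbb{S}_d)$; all densities on $\mathbb{S}_d$ are with respect to $\mathrm{unif}(\mathbb{S}_d)$, $\eta^{t}x$ is the Euclidean inner product, $\mathbb{N}_0=\{0,1,2,\dots\}$. Discrete mixture representation: given a family $\{P_{\eta,\rho}:\eta\in\mathbb{S}_d,\rho\in I\}$ of probability measures on $\mathbb{S}_d$ and, for each $\eta$, a sequence $(Q_{n,\eta})_{n\in\mathbb{N}_0}$ of probability measures on $\mathbb{S}_d$ (the mixing base), a discrete mixture representation of the family with this mixing base is a family $(w_\rho)_{\rho\in I}$ of probability mass functions on $\mathbb{N}_0$ (depending on $\rho$ only) with $P_{\eta,\rho}=\sum_{n=0}^\infty w_\rho(n)Q_{n,\eta}$ (pointwise on Borel sets) for all $\eta\in\mathbb{S}_d$, $\rho\in I$. It is unique if there is exactly one such family $(w_\rho)_{\rho\in I}$. $\mathrm{AG}_d(\eta,\rho)$, $\eta\in\mathbb{S}_d$,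 $\rho>0$, is the distribution of $Z/\|Z\|$ where $Z$ has the $(d+1)$-variate normal distribution with identity covariance matrix and mean vector $a\neq0$ such that $\eta=a/\|a\|$ and $\rho=(\tfrac12\|a\|^2)^{1/2}$ (i.e. $a=2^{1/2}\rho\,\eta$). Its density is $x\mapsto e^{-\rho^2}\sum_{k=0}^\infty(2\rho\,\eta^{t}x)^k\frac{\Gamma((d+1+k)/2)}{k!\,\Gamma((d+1)/2)}$. $\mathrm{SBeta}_d(\eta,p,q)$, $p,q>\frac12-\lambda$, has density $x\mapsto c_d(p,q)(1-\eta^{t}x)^{p-1}(1+\eta^{t}x)^{q-1}$ with $c_d(p,q)=2^{-(p+q+2(\lambda-1))}\frac{\Gamma(1/2)\Gamma(\lambda+1/2)\Gamma(p+q+2\lambda-1)}{\Gamma(\lambda+1)\Gamma(p+\lambda-1/2)\Gamma(q+\lambda-1/2)}$. For $\nu<0$ the parabolic cylinder function is $D_\nu(z)=\frac{e^{-z^2/4}}{\Gamma(-\nu)}\int_0^\infty t^{-\nu-1}e^{-zt-t^2/2}\,dt$, $z\in\mathbb{R}$. For $\delta>\frac12$, $\tau>0$, $k\in\mathbb{N}_0$, $$\mathrm{dpc}(k|\delta,\tau)=\frac{1}{k!}(2^{1/2}\tau)^k\,2^{k+\delta-1}\,\frac{(k+2\delta-1)\,\Gamma(k+\delta-\frac12)}{\Gamma(\frac12)}\,e^{-\tau^2/2}\,D_{-(k+2\delta)}(2^{1/2}\tau).$$ *)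

(* Defs.v *)
From HB Require Import structures.
From mathcomp Require Import all_boot all_order all_algebra.
From mathcomp Require Import all_classical all_reals all_analysis.
From mathcomp Require Import measurable_realfun lebesgue_integral_fubini.

Set Implicit Arguments.
Unset Strict Implicit.
Unset Printing Implicit Defensive.

Import Order.TTheory GRing.Theory Num.Theory.
Import numFieldNormedType.Exports.

Local Open Scope classical_set_scope.
Local Open Scope ring_scope.

(** The library's sigma-algebra on tuples is the product one, so the measurable
    sets of [rvec R n] are the Borel sets of R^n. *)
Notation rvec R n := (n.-tuple (measurableTypeR R)).

Section Euclidean.
Context {R : realType} {n : nat}.
Implicit Types x y : rvec R n.

Definition dotp x y : R := \sum_(i < n) (tnth x i : R) * tnth y i.

Definition enorm x : R := Num.sqrt (dotp x x).

Definition scalet (a : R) x : rvec R n := [tuple a * (tnth x i : R) | i < n].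

Lemma dotpxx_ge0 x : 0 <= dotp x x.
Proof. by apply: sumr_ge0 => i _; rewrite -expr2 sqr_ge0. Qed.

Lemma enorm_scale a x : enorm (scalet a x) = `|a| * enorm x.
Proof.
rewrite /enorm (_ : dotp (scalet a x) _ = a ^+ 2 * dotp x x); last first.
  rewrite /dotp mulr_sumr; apply: eq_bigr => i _.
  by rewrite !tnth_mktuple mulrACA -expr2.
by rewrite sqrtrM ?sqr_ge0// sqrtr_sqr.
Qed.

Lemma enorm_le1 x : (enorm x <= 1) = (dotp x x <= 1).
Proof. by rewrite /enorm -[X in _ <= X]sqrtr1 ler_sqrt ?ltr01. Qed.

Lemma measurable_dotpxx : measurable_fun [set: rvec R n] (fun x => dotp x x).
Proof.
apply: measurable_sum => i.
by apply: measurable_funM; exact: measurable_tnth.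
Qed.

Lemma measurable_enormV :
  measurable_fun [set: rvec R n] (fun x => (enorm x)^-1).
Proof.
rewrite (_ : (fun _ => _) = (fun r => r `^ (-1)) \o (fun r => r `^ (2^-1))
    \o (fun x => dotp x x)); last first.
  apply/funext => x /=; rewrite powR12_sqrt ?dotpxx_ge0//.
  by rewrite powR_inv1// sqrtr_ge0.
apply: measurableT_comp; last exact: measurable_dotpxx.
by apply: measurableT_comp; exact: measurable_powR.
Qed.

End Euclidean.

(** [sphere R d] is the unit sphere of R^(d+1), not of R^d. *)

Section Sphere.
Variables (R : realType) (d : nat).

Record sphere :=
  Sphere { sphere_val : rvec R d.+1; _ : enorm sphere_val == 1 }.

HB.instance Definition _ := [isSub of sphere for sphere_val].
HB.instance Definition _ := [Choice of sphere by <:].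

Lemma enorm_e0 : enorm [tuple (i == ord0)%:R : R | i < d.+1] == 1.
Proof.
rewrite /enorm /dotp big_ord_recl !tnth_mktuple mulr1 big1 ?addr0 ?sqrtr1//.
by move=> i _; rewrite !tnth_mktuple mulr0.
Qed.

HB.instance Definition _ := isPointed.Build sphere (Sphere enorm_e0).

(** Trace of the Borel sigma-algebra of R^(d+1). *)
HB.instance Definition _ :=
  Measurable.copy sphere (g_sigma_algebra_preimageType sphere_val).


Definition normalize (z : rvec R d.+1) : sphere :=
  insubd (point : sphere) (scalet (enorm z)^-1 z).

Lemma sphere_val_normalize z : sphere_val (normalize z) =
  if 0 < dotp z z then scalet (enorm z)^-1 z else sphere_val (point : sphere).
Proof.
rewrite [LHS]val_insubd enorm_scale normfV ger0_norm ?sqrtr_ge0//=.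
have [z0|z0] := ltP 0 (dotp z z).
  by rewrite mulVf ?eqxx// /enorm sqrtr_eq0 -ltNge.
by rewrite /enorm ler0_sqrtr// mulr0 eq_sym oner_eq0.
Qed.

Lemma measurable_normalize : measurable_fun [set: rvec R d.+1] normalize.
Proof.
suff mz : measurable_fun [set: rvec R d.+1] (sphere_val \o normalize).
  by move=> mT _ [B mB <-]; rewrite setTI -comp_preimage; exact: mz.
rewrite (_ : _ \o _ = fun z : rvec R d.+1 =>
    if 0 < dotp z z then scalet (enorm z)^-1 z
    else sphere_val (point : sphere)); last first.
  by apply/funext => z /=; exact: sphere_val_normalize.
apply: measurable_fun_ifT => //.
- by apply: measurable_fun_ltr => //; exact: measurable_dotpxx.
- apply/measurable_fun_tnthP => i.
  rewrite (_ : _ \o _ = fun z : rvec R d.+1 => (enorm z)^-1 * tnth z i).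
    by apply: measurable_funM;
      [exact: measurable_enormV|exact: measurable_tnth].
  by apply/funext => z /=; rewrite tnth_mktuple.
Qed.

HB.instance Definition _ :=
  isMeasurableFun.Build _ _ _ _ normalize measurable_normalize.

End Sphere.

(** Product measures on tuples, obtained by iterating the binary product
    measure along [tcons]. *)

Section Product.
Context {d : measure_display} {T : measurableType d} {R : realType}.

Definition tcons {n} (p : T * n.-tuple T) : n.+1.-tuple T :=
  [tuple of p.1 :: p.2].

Definition tuncons {n} (t : n.+1.-tuple T) : T * n.-tuple T :=
  (tnth t ord0, [tuple of behead t]).

Lemma tconsK n : cancel (@tcons n) tuncons.
Proof. by case=> x t; congr pair; apply/val_inj. Qed.

Lemma measurable_tcons n : measurable_fun [set: T * n.-tuple T] (@tcons n).
Proof. exact: (measurable_cons measurable_fst measurable_snd). Qed.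

Lemma measurable_tuncons n : measurable_fun [set: n.+1.-tuple T] (@tuncons n).
Proof.
by apply/measurable_fun_pair => /=;
  [exact: measurable_tnth|exact: measurable_behead].
Qed.

Section Step.
Variables (n : nat) (mu : {sigma_finite_measure set T -> \bar R}).
Variable nu : {sigma_finite_measure set (n.-tuple T) -> \bar R}.

Let munu : {measure set (T * n.-tuple T)%type -> \bar R} :=
  (mu \x nu)%E.

Definition product_cons : set (n.+1.-tuple T) -> \bar R :=
  pushforward (mu \x nu)%E (@tcons n).

Let mtcons A : measurable A -> measurable (@tcons n @^-1` A).
Proof.
by move=> mA; rewrite -[X in measurable X]setTI; exact: measurable_tcons.
Qed.

Let product_cons0 : product_cons set0 = 0%E.
Proof. by rewrite /product_cons /pushforward preimage_set0 measure0. Qed.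

Let product_cons_ge0 A : (0 <= product_cons A)%E.
Proof. exact: (measure_ge0 munu). Qed.

Let product_cons_sigma_additive : semi_sigma_additive product_cons.
Proof.
move=> F mF tF mUF; rewrite /product_cons /pushforward preimage_bigcup.
apply: (@measure_semi_sigma_additive _ _ _ munu).
- by move=> i; exact: mtcons.
- apply/trivIsetP => i j _ _ ij; rewrite -preimage_setI.
  by move/trivIsetP : tF => /(_ _ _ _ _ ij) ->//; rewrite preimage_set0.
- by rewrite -preimage_bigcup; exact: mtcons.
Qed.

HB.instance Definition _ := isMeasure.Build _ _ _ product_cons
  product_cons0 product_cons_ge0 product_cons_sigma_additive.

Let product_cons_sigma_finite : sigma_finite setT product_cons.
Proof.
have /sigma_finiteP[F [FT ndF Foo]] := sigma_finiteT mu.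
have /sigma_finiteP[G [GT ndG Goo]] := sigma_finiteT nu.
exists (fun k => tuncons @^-1` (F k `*` G k)) => [|k].
  rewrite -preimage_bigcup (_ : \bigcup_i _ = setT) ?preimage_setT//.
  apply/seteqP; split => // -[x y] _.
  have [i _ Fix] : (\bigcup_i F i) x by rewrite -FT.
  have [j _ Gjy] : (\bigcup_i G i) y by rewrite -GT.
  exists (maxn i j) => //; split.
  - by move: x Fix; exact/subsetPset/ndF/leq_maxl.
  - by move: y Gjy; exact/subsetPset/ndG/leq_maxr.
have [mF Fk] := Foo k; have [mG Gk] := Goo k.
split.
  by rewrite -[X in measurable X]setTI; apply: measurable_tuncons => //;
    exact: measurableX.
rewrite /product_cons /pushforward -comp_preimage.
rewrite (_ : _ \o _ = id) ?preimage_id; last first.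
  by apply/funext => p /=; rewrite tconsK.
by rewrite product_measure1E// lte_mul_pinfty// ge0_fin_numE.
Qed.

HB.instance Definition _ := Measure_isSigmaFinite.Build _ _ _ product_cons
  product_cons_sigma_finite.

End Step.

Fixpoint tuple_product n :
    ('I_n -> {sigma_finite_measure set T -> \bar R}) ->
    {sigma_finite_measure set (n.-tuple T) -> \bar R} :=
  match n with
  | 0 => fun=> \d_([tuple] : 0.-tuple T)
  | m.+1 => fun mu =>
      product_cons (mu ord0) (tuple_product (fun i => mu (lift ord0 i)))
  end.

Lemma tuple_product_setT n
    (mu : 'I_n -> {sigma_finite_measure set T -> \bar R}) :
  (forall i, mu i setT = 1%E) -> tuple_product mu setT = 1%E.
Proof.
elim: n mu => [|n IHn] mu mu1 /=; first by rewrite diracT.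
rewrite /product_cons /pushforward preimage_setT -setXTT.
by rewrite product_measure1E// [X in (X * _)%E]mu1 [X in (_ * X)%E]IHn ?mule1.
Qed.

End Product.

Section SphereDistributions.
Context {R : realType}.

Definition lebesgue_tuple n : {sigma_finite_measure set (rvec R n) -> \bar R} :=
  tuple_product (fun=> @lebesgue_measure R).

(** The n-variate normal distribution with mean [a] and identity covariance. *)
Definition gaussian n (a : rvec R n) : set (rvec R n) -> \bar R :=
  tuple_product (fun i => normal_prob (tnth a i) 1).

HB.instance Definition _ n (a : rvec R n) := Measure.on (gaussian a).

Lemma gaussian_setT n (a : rvec R n) : gaussian a setT = 1%E.
Proof. by apply: tuple_product_setT => i; exact: probability_setT. Qed.

HB.instance Definition _ n (a : rvec R n) :=
  Measure_isProbability.Build _ _ _ (gaussian a) (gaussian_setT a).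

Definition unit_ball n : set (rvec R n) := [set z | enorm z <= 1].
Arguments unit_ball : clear implicits.

Lemma measurable_unit_ball n : measurable (unit_ball n).
Proof.
rewrite (_ : unit_ball n =
    [set: rvec R n] `&` (fun z => dotp z z) @^-1` `]-oo, 1]).
  by apply: measurable_dotpxx.
by apply/seteqP; split => z; rewrite /unit_ball/= in_itv/= enorm_le1 // => -[].
Qed.

Arguments measurable_unit_ball : clear implicits.

(** Normalized surface measure, as the cone measure: the law of X/|X| for X
    uniform in the unit ball. The default [\d_point] of [mnormalize] is not
    used, the volume of the ball being positive and finite. *)
Definition unif_sphere d : probability (sphere R d) R :=
  distribution
    (mnormalize (mrestr (lebesgue_tuple d.+1) (measurable_unit_ball d.+1))
       \d_point)
    (@normalize R d).

(** Law of Z/|Z| for Z normal with mean [2^(1/2) rho eta] and identity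
    covariance. *)
Definition angular_gaussian d (eta : sphere R d) (rho : R) :
    probability (sphere R d) R :=
  distribution (gaussian (scalet (Num.sqrt 2 * rho) (sphere_val eta)))
    (@normalize R d).

End SphereDistributions.

Section SpecialFunctions.
Context {R : realType}.

(** Meaningful for [0 < x] only. *)
Definition Gamma (x : R) : R :=
  \int[lebesgue_measure]_(t in `]0, +oo[) (t `^ (x - 1) * expR (- t)).

(** D_nu(z), by its integral representation, valid for [nu < 0]. *)
Definition parabolic_cylinder (nu z : R) : R :=
  expR (- (z ^+ 2 / 4)) / Gamma (- nu) *
  \int[lebesgue_measure]_(t in `]0, +oo[)
     (t `^ (- nu - 1) * expR (- (z * t) - t ^+ 2 / 2)).

Definition dpc (delta tau : R) (k : nat) : R :=
  k`!%:R^-1 * (Num.sqrt 2 * tau) ^+ k * 2 `^ (k%:R + delta - 1) *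
  ((k%:R + 2 * delta - 1) * Gamma (k%:R + delta - 2^-1) / Gamma 2^-1) *
  expR (- (tau ^+ 2 / 2)) *
  parabolic_cylinder (- (k%:R + 2 * delta)) (Num.sqrt 2 * tau).

Definition lambda_of (d : nat) : R := (d%:R - 1) / 2.

Definition sbeta_const (d : nat) (p q : R) : R :=
  let l := lambda_of d in
  2 `^ (- (p + q + 2 * (l - 1))) *
  (Gamma 2^-1 * Gamma (l + 2^-1) * Gamma (p + q + 2 * l - 1)) /
  (Gamma (l + 1) * Gamma (p + l - 2^-1) * Gamma (q + l - 2^-1)).

Definition sbeta_density d (eta : sphere R d) (p q : R) (x : sphere R d) : R :=
  let u := dotp (sphere_val eta) (sphere_val x) in
  sbeta_const d p q * (1 - u) `^ (p - 1) * (1 + u) `^ (q - 1).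

Definition sbeta d (eta : sphere R d) (p q : R) (A : set (sphere R d)) :
    \bar R :=
  (\int[unif_sphere d]_(x in A) (sbeta_density eta p q x)%:E)%E.

End SpecialFunctions.

Section DiscreteMixture.
Context {disp : measure_display} {T : measurableType disp} {R : realType}.

Definition is_pmf (w : nat -> R) : Prop :=
  (forall n, 0 <= w n) /\ (\sum_(0 <= n <oo) (w n)%:E = 1)%E.

Definition is_probability (mu : set T -> \bar R) : Prop :=
  exists P : probability T R, forall A, measurable A -> mu A = P A.

(** [H] indexes the locations eta, [I] the parameters rho. That the elements of
    the mixing base [Q] are probability measures is part of the definition. *)
Definition discrete_mixture_representation (H I : Type)
    (P : H -> I -> probability T R) (Q : nat -> H -> set T -> \bar R)
    (w : I -> nat -> R) : Prop :=
  [/\ forall n eta, is_probability (Q n eta),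
      forall rho, is_pmf (w rho)
    & forall eta rho A, measurable A ->
        P eta rho A = (\sum_(0 <= n <oo) (w rho n)%:E * Q n eta A)%E].

End DiscreteMixture.

(* Main.v *)
(** Put u = eta . x and s = 2^(1/2) rho. The standard Gaussian density shifted by
    s eta is, up to a constant, exp (- |z|^2/2 + s |z| u(z/|z|)), and
    exp (s |z| u) = exp (- s |z|) * sum_k (s |z| (1 + u))^k / k!
    is a series of nonnegative terms. Integrating in polar coordinates term by
    term gives AG as a mixture of the laws with density proportional to
    (1 + u)^k; the radial integrals are parabolic cylinder functions.

    The normalizing constants come from the moments of u under the uniform law.
    These are obtained by comparing, in polar coordinates, with the moments of
    the standard normal variable eta . Z, and they yield the recursion
    (n + j + d) B(j, n+1) = (2n + d) B(j, n) for B(j, n) = E (1-u)^j (1+u)^n.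

    For uniqueness, the integral of (1 - u)^j against the n-th component is
    q(j, n) with q(j, n+1) / q(j, n) = (n + d) / (n + j + d), which tends to 0 as
    j grows, so that the weights can be recovered one after the other. *)
From HB Require Import structures.
Require Import Defs.
From mathcomp Require Import all_boot all_order all_algebra.
From mathcomp Require Import all_classical all_reals all_analysis.
From mathcomp Require Import measurable_realfun lebesgue_integral_fubini.
From mathcomp Require Import ring lra.

Set Implicit Arguments.
Unset Strict Implicit.
Unset Printing Implicit Defensive.

Import Order.TTheory GRing.Theory Num.Theory.
Import numFieldNormedType.Exports.

Local Open Scope classical_set_scope.
Local Open Scope ring_scope.

(** * Integration on R and on tuples *)

(** The uniform law is a cone measure, so polar coordinates have to be derived from Lebesgue measure
    on tuples; the geometric inputs are homotheties, affine substitutions on the line and Tonelli.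
    The spherical moments rest on homogeneity: if f is homogeneous of degree k and Z is standard
    normal, then E f(eta . Z) = E |Z|^k E f(u). This makes the moments of u quotients of the numbers
    [gaussR k], the integrals of r^k exp (- r^2/2) over r > 0. The same numbers, up to powers of 2,
    are the values of Gamma at positive half-integers, and only such values occur in [sbeta_const]
    and [dpc] here. All constants are therefore compared through the single recursion
    [gaussR k.+2 = k.+1%:R * gaussR k]. The condition d >= 1 keeps the factors n + j + d and 2n + d
    positive, also at n = j = 0; the positivity of the moments and the uniqueness argument depend on
    this. *)

Section LebesgueAffine.
Context {R : realType}.
Local Notation leb := (@lebesgue_measure R).

Lemma measurable_affine (c b : R) :
  measurable_fun [set: measurableTypeR R]
    (fun x : measurableTypeR R => c * x + b : measurableTypeR R).
Proof. by apply: measurable_funD => //; exact: measurable_funM. Qed.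

(** The right side is a measure in [A] with the correct value on half-open intervals, which
    characterizes Lebesgue measure. *)
Lemma lebesgue_measure_affine (c b : R) (A : set (measurableTypeR R)) :
  0 < c -> measurable A ->
  leb A = (c%:E * leb ((fun x => c * x + b)%R @^-1` A))%E.
Proof.
move=> c0 mA.
pose m := mscale (NngNum (ltW c0))
  (measure_function_pushforward__canonical__measure_function_Measure
    leb (measurable_affine c b)).
rewrite (@lebesgue_measure_unique R m)// => _ [[x y] xy <-] /=.
rewrite /m/= /mscale/= /pushforward/=.
rewrite (_ : _ @^-1` _ = `](x - b) / c, (y - b) / c]%classic); last first.
  apply/seteqP; split => z /=; rewrite !in_itv/= ltr_pdivrMr// ler_pdivlMr//;
    by rewrite ltrBlDr lerBrDr mulrC.
rewrite !lebesgue_measure_itv/= !lte_fin ltr_pM2r ?invr_gt0// ltrD2r.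
case: ifPn => _; last by rewrite mule0.
by rewrite -!EFinD -EFinM; congr EFin; field; rewrite gt_eqF.
Qed.

Lemma integral_affine (c b : R) (f : R -> \bar R) : 0 < c ->
  measurable_fun setT f -> (forall x, 0 <= f x)%E ->
  (\int[leb]_x f x = c%:E * \int[leb]_x f (c * x + b)%R)%E.
Proof.
move=> c0 mf f0.
pose m := mscale (NngNum (ltW c0))
  (measure_function_pushforward__canonical__measure_function_Measure
    leb (measurable_affine c b)).
rewrite (@eq_measure_integral _ _ _ _ m); last first.
  by move=> A mA _; rewrite [LHS](lebesgue_measure_affine b c0 mA).
rewrite ge0_integral_mscale//= ge0_integral_pushforward//.
exact: measurable_affine.
Qed.

End LebesgueAffine.

Section TupleFubini.
Context {d : measure_display} {T : measurableType d} {R : realType}.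

Lemma ge0_integral_tuple_product n
    (mu : 'I_n.+1 -> {sigma_finite_measure set T -> \bar R})
    (f : n.+1.-tuple T -> \bar R) :
  measurable_fun setT f -> (forall z, 0 <= f z)%E ->
  (\int[tuple_product mu]_z f z =
   \int[mu ord0]_x
     \int[tuple_product (fun i => mu (lift ord0 i))]_y f (tcons (x, y)))%E.
Proof.
move=> mf f0 /=; rewrite /product_cons.
rewrite ge0_integral_pushforward//; last exact: measurable_tcons.
rewrite preimage_setT fubini_tonelli1//; last by move=> x; exact: f0.
exact: (measurableT_comp mf (@measurable_tcons _ _ n)).
Qed.

End TupleFubini.

(** * Integration against a measure given by a density *)

Section Density.
Context {d : measure_display} {T : measurableType d} {R : realType}.
Variables (mu nu : {measure set T -> \bar R}) (g : T -> R).
Hypotheses (mg : measurable_fun setT g) (g0 : forall x, 0 <= g x).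
Hypothesis nuE : forall A, measurable A -> nu A = (\int[mu]_(x in A) (g x)%:E)%E.

Import HBNNSimple.

Let integral_nnsfun_density (h : {nnsfun T >-> R}) :
  (\int[nu]_x (h x)%:E = \int[mu]_x ((h x)%:E * (g x)%:E))%E.
Proof.
rewrite integralT_nnsfun sintegralE.
transitivity (\int[mu]_x (\sum_(r \in range h) (r * \1_(h @^-1` [set r]) x * g x)%:E))%E.
  rewrite ge0_integral_fsum//; last 2 first.
  - move=> r; apply/measurable_EFinP; apply: measurable_funM => //.
    exact: measurable_funM.
  - by move=> r x _; rewrite lee_fin mulr_ge0// -lee_fin nnfun_muleindic_ge0.
  apply: eq_fsbigr => r /[!inE] -[t _ <-].
  rewrite nuE//.
  under [RHS]eq_integral do rewrite -mulrA EFinM.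
  rewrite ge0_integralZl//; last 3 first.
  - by apply/measurable_EFinP; exact: measurable_funM.
  - by move=> x _; rewrite lee_fin mulr_ge0.
  - by rewrite lee_fin.
  congr (_ * _)%E; rewrite integral_mkcond; apply: eq_integral => x _.
  by rewrite patchE indicE; case: ifPn => _; rewrite ?mul1r ?mul0r.
apply: eq_integral => x _.
rewrite (fimfunE h x) -fsumEFin// ge0_mule_fsuml.
  by apply: eq_fsbigr => r _; rewrite EFinM.
by move=> r; rewrite nnfun_muleindic_ge0.
Qed.

(** On sets this is [nuE]; linearity extends it to simple functions and monotone convergence to all
    of them. It serves the normal law, the uniform law on the sphere and the components of a
    mixture. *)
Lemma ge0_integral_density (f : T -> \bar R) : measurable_fun setT f ->
  (forall x, 0 <= f x)%E -> (\int[nu]_x f x = \int[mu]_x (f x * (g x)%:E))%E.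
Proof.
move=> mf f0; pose f_ := nnsfun_approx measurableT mf.
have cf x : EFin \o f_^~ x @ \oo --> f x by apply: cvg_nnsfun_approx.
have ndf x : {homo (fun n => (f_ n x)%:E) : a b / (a <= b)%N >-> (a <= b)%E}.
  by move=> a b ab; rewrite lee_fin; exact/lefP/nd_nnsfun_approx.
transitivity (limn (fun n => \int[nu]_x (f_ n x)%:E)%E).
  rewrite -monotone_convergence//.
  - by apply: eq_integral => x _; apply/esym/cvg_lim => //; exact: cf.
  - by move=> n; exact/measurable_EFinP.
  - by move=> n x _; rewrite lee_fin.
transitivity (limn (fun n => \int[mu]_x ((f_ n x)%:E * (g x)%:E))%E).
  by congr (limn _); apply/funext => n; exact: integral_nnsfun_density.
rewrite -monotone_convergence//.
- apply: eq_integral => x _; apply/cvg_lim => //.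
  by apply: cvgeZr => //; exact: cf.
- by move=> n; apply/measurable_EFinP; exact: measurable_funM.
- by move=> n x _; rewrite -EFinM lee_fin mulr_ge0.
- by move=> x _ a b ab; rewrite lee_pmul// ?lee_fin//; exact: ndf.
Qed.

End Density.

(** * Lebesgue and Gaussian integrals on tuples, one coordinate at a time *)

Section TupleIntegrals.
Context {R : realType}.
Local Notation leb := (@lebesgue_measure R).

Lemma measurable_dotp n (a : rvec R n) :
  measurable_fun [set: rvec R n] (dotp a).
Proof.
apply: measurable_sum => i.
by apply: measurable_funM => //; exact: measurable_tnth.
Qed.

Lemma measurable_scalet n (c : R) : measurable_fun [set: rvec R n] (scalet c).
Proof.
apply/measurable_fun_tnthP => i.
rewrite (_ : _ \o _ = fun z : rvec R n => c * tnth z i).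
  by apply: measurable_funM => //; exact: measurable_tnth.
by apply/funext => z /=; rewrite tnth_mktuple.
Qed.

Lemma tnth_tcons0 n (x : R) (y : rvec R n) : tnth (tcons (x, y)) ord0 = x.
Proof. by []. Qed.

Lemma tnth_tconsS n (x : R) (y : rvec R n) i :
  tnth (tcons (x, y)) (lift ord0 i) = tnth y i.
Proof. by rewrite !(tnth_nth 0). Qed.

Lemma tnth_tuncons2 n (a : rvec R n.+1) i :
  tnth (tuncons a).2 i = tnth a (lift ord0 i).
Proof. by rewrite !(tnth_nth 0) /= nth_behead. Qed.

Lemma scalet_tcons n (c x : R) (y : rvec R n) :
  scalet c (tcons (x, y)) = tcons (c * x, scalet c y).
Proof.
apply: eq_from_tnth => i; rewrite tnth_mktuple.
case: (unliftP ord0 i) => [j|] ->; last by rewrite !tnth_tcons0.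
by rewrite !tnth_tconsS tnth_mktuple.
Qed.

Lemma dotp_tcons n (a : rvec R n.+1) (x : R) (y : rvec R n) :
  dotp a (tcons (x, y)) =
  tnth a ord0 * x + dotp (tuncons a).2 y.
Proof.
rewrite /dotp big_ord_recl; congr (_ + _).
apply: eq_bigr => i _; rewrite tnth_tconsS; congr (_ * _).
by rewrite tnth_tuncons2.
Qed.

Lemma measurable_tcons1 n (x : R) : measurable_fun [set: rvec R n]
  (fun y => tcons (x, y) : rvec R n.+1).
Proof. exact: (measurableT_comp (@measurable_tcons _ _ n)). Qed.

Lemma ge0_integral_lebesgue_tuple n (f : rvec R n.+1 -> \bar R) :
  measurable_fun setT f -> (forall z, 0 <= f z)%E ->
  (\int[lebesgue_tuple n.+1]_z f z =
   \int[leb]_x \int[lebesgue_tuple n]_y f (tcons (x, y)))%E.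
Proof. exact: ge0_integral_tuple_product. Qed.

Lemma measurable_fun_int_tcons n
  (nu : {sigma_finite_measure set (rvec R n) -> \bar R})
  (f : rvec R n.+1 -> \bar R) :
  measurable_fun setT f -> (forall z, 0 <= f z)%E ->
  measurable_fun [set: measurableTypeR R]
    (fun x => \int[nu]_y f (tcons (x, y)))%E.
Proof.
move=> mf f0.
apply: (measurable_fun_fubini_tonelli_F (m2 := nu) (f \o tcons)) => //=.
exact: (measurableT_comp mf (@measurable_tcons _ _ n)).
Qed.

(** Each coordinate contributes one factor [c], by the affine substitution on the line. *)
Lemma ge0_integral_scalet n (c : R) (f : rvec R n -> \bar R) : 0 < c ->
  measurable_fun setT f -> (forall z, 0 <= f z)%E ->
  (\int[lebesgue_tuple n]_z f z =
   (c ^+ n)%:E * \int[lebesgue_tuple n]_z f (scalet c z))%E.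
Proof.
move=> c0; elim: n f => [|n IHn] f mf f0.
  rewrite expr0 mul1e; apply: eq_integral => z _.
  by congr f; apply: eq_from_tnth => -[].
rewrite !ge0_integral_lebesgue_tuple//; last first.
  by apply: measurableT_comp => //; exact: measurable_scalet.
rewrite [LHS](integral_affine 0 c0); last 2 first.
- exact: measurable_fun_int_tcons.
- by move=> x; exact: integral_ge0.
have m1 (x : R) : measurable_fun setT (fun y : rvec R n => f (tcons (x, y))).
  by apply: measurableT_comp => //; exact: measurable_tcons1.
rewrite exprS EFinM -muleA; congr (_ * _)%E.
rewrite -ge0_integralZl//; last 3 first.
- apply: (@measurable_fun_int_tcons n (lebesgue_tuple n) (fun z => f (scalet c z))) => //.
  by apply: measurableT_comp => //; exact: measurable_scalet.
- by move=> x _; exact: integral_ge0.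
- by rewrite lee_fin exprn_ge0// ltW.
apply: eq_integral => x _; rewrite addr0 IHn//; last exact: m1.
by congr (_ * _)%E; apply: eq_integral => y _; rewrite scalet_tcons.
Qed.

Lemma normal_pdf1E (m x : R) :
  normal_pdf m 1 x = (Num.sqrt (pi *+ 2))^-1 * expR (- (x - m) ^+ 2 / 2).
Proof.
by rewrite /normal_pdf oner_eq0 /normal_peak /normal_fun !expr1n mul1r.
Qed.

Lemma ge0_integral_normal_prob (m : R) (f : R -> \bar R) :
  measurable_fun setT f -> (forall z, 0 <= f z)%E ->
  (\int[normal_prob m 1]_x f x = \int[leb]_x (f x * (normal_pdf m 1 x)%:E))%E.
Proof.
move=> mf f0; apply: ge0_integral_density => //.
  exact: measurable_normal_pdf.
exact: normal_pdf_ge0.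
Qed.

Lemma measurable_prod_normal_pdf n (a : rvec R n) :
  measurable_fun setT
   (fun z : rvec R n => \prod_(i < n) normal_pdf (tnth a i) 1 (tnth z i)).
Proof.
apply: measurable_prod => i _.
apply: (measurableT_comp (measurable_normal_pdf _ _)).
exact: measurable_tnth.
Qed.

Lemma prod_normal_pdf_ge0 n (a z : rvec R n) :
  0 <= \prod_(i < n) normal_pdf (tnth a i) 1 (tnth z i).
Proof. by apply: prodr_ge0 => i _; exact: normal_pdf_ge0. Qed.

Lemma ge0_integral_gaussian n (a : rvec R n) (f : rvec R n -> \bar R) :
  measurable_fun setT f -> (forall z, 0 <= f z)%E ->
  (\int[gaussian a]_z f z = \int[lebesgue_tuple n]_z
     (f z * (\prod_(i < n) normal_pdf (tnth a i) 1 (tnth z i))%:E))%E.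
Proof.
elim: n a f => [|n IHn] a f mf f0.
  rewrite /gaussian /=; apply: eq_integral => z _.
  by rewrite big_ord0 mule1.
rewrite [LHS]ge0_integral_tuple_product//.
have m1 (x : R) : measurable_fun setT (fun y : rvec R n => f (tcons (x, y))).
  by apply: measurableT_comp => //; exact: measurable_tcons1.
rewrite ge0_integral_normal_prob//; last 2 first.
- exact: measurable_fun_int_tcons.
- by move=> x; exact: integral_ge0.
rewrite ge0_integral_lebesgue_tuple//; last 2 first.
- apply: emeasurable_funM => //.
  by apply/measurable_EFinP; exact: measurable_prod_normal_pdf.
- by move=> z; rewrite mule_ge0// lee_fin prod_normal_pdf_ge0.
apply: eq_integral => x _.
(* The remaining factors form the Gaussian law centred at the tail of [a], to which the induction
   hypothesis applies. *)
have -> : (fun i => normal_prob (tnth a (lift ord0 i)) 1) =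
    (fun i => normal_prob (tnth (tuncons a).2 i) 1)
    :> ('I_n -> {sigma_finite_measure set (measurableTypeR R) -> \bar R}).
  by apply/funext => i; rewrite tnth_tuncons2.
rewrite [X in (X * _)%E]IHn//; last exact: m1.
rewrite -ge0_integralZr//; last 3 first.
- apply: emeasurable_funM; first exact: m1.
  by apply/measurable_EFinP; exact: measurable_prod_normal_pdf.
- by move=> y _; rewrite mule_ge0// lee_fin prod_normal_pdf_ge0.
- by rewrite lee_fin normal_pdf_ge0.
apply: eq_integral => y _; rewrite -muleA -EFinM; congr (_ * _%:E)%E.
rewrite big_ord_recl tnth_tcons0 mulrC; congr (_ * _).
by apply: eq_bigr => i _; rewrite tnth_tconsS tnth_tuncons2.
Qed.

End TupleIntegrals.

(** * Linear functionals of a standard Gaussian vector *)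

Section GaussianProjection.
Context {R : realType}.
Local Notation leb := (@lebesgue_measure R).
Local Notation phi := (@normal_pdf R 0 1).

Lemma integral_oppr (f : R -> \bar R) :
  measurable_fun setT f -> (forall x, 0 <= f x)%E ->
  (\int[leb]_x f x = \int[leb]_x f (- x)%R)%E.
Proof.
move=> mf f0.
transitivity (\int[pushforward leb (-%R : measurableTypeR R -> measurableTypeR R)]_x f x)%E.
  by apply: eq_measure_integral => A mA _; rewrite -[LHS]lebesgue_measureN.
by rewrite ge0_integral_pushforward.
Qed.

Lemma normal_pdf01E (x : R) :
  phi x = (Num.sqrt (pi *+ 2))^-1 * expR (- x ^+ 2 / 2).
Proof. by rewrite normal_pdf1E subr0. Qed.

Lemma normal_pdf01N (x : R) : phi (- x) = phi x.
Proof. by rewrite !normal_pdf01E sqrrN. Qed.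

Let mphi : measurable_fun [set: measurableTypeR R] phi := measurable_normal_pdf 0 1.
Let phi0 x : 0 <= phi x := normal_pdf_ge0 0 1 x.

(* The variable [(s / b) x - a y / (s b)] completes the square in [x]. *)
Lemma normal_pdf01_rot (a b s x y : R) : 0 < b -> 0 < s ->
  s ^+ 2 = a ^+ 2 + b ^+ 2 ->
  phi x * phi (b^-1 * y - b^-1 * (a * x)) =
  phi (s^-1 * y) * phi (s / b * x + - (a * y / (s * b))).
Proof.
move=> b0 s0 sab; rewrite !normal_pdf01E mulrACA [RHS]mulrACA -!expRD.
congr (_ * expR _).
have {}sab : a * a = s ^+ 2 - b ^+ 2 by rewrite sab addrK expr2.
have b1 : b != 0 by rewrite gt_eqF.
have s1 : s != 0 by rewrite gt_eqF.
have -> : - x ^+ 2 / 2 + - (b^-1 * y - b^-1 * (a * x)) ^+ 2 / 2 =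
  - (x ^+ 2 * (b^+2 + a * a) + y ^+ 2 - 2 * a * x * y) / b ^+ 2 / 2 by field.
have -> : - (s^-1 * y) ^+ 2 / 2 + - (s / b * x + - (a * y / (s * b))) ^+ 2 / 2 =
  - (s ^+ 4 * x ^+ 2 + y ^+ 2 * (b ^+ 2 + a * a) - 2 * s ^+ 2 * a * x * y)
    / s ^+ 2 / b ^+ 2 / 2 by field; rewrite b1.
by rewrite sab; field; rewrite b1.
Qed.

(** For independent standard normal X and Y, a X + b Y has the law of s X. In the application [b]
    and [s] are norms, while [a] is a coordinate of either sign. *)
Lemma ge0_integral_gauss2 (a b s : R) (f : R -> \bar R) : 0 <= b -> 0 <= s ->
  s ^+ 2 = a ^+ 2 + b ^+ 2 ->
  measurable_fun setT f -> (forall x, 0 <= f x)%E ->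
  (\int[leb]_x ((\int[leb]_y (f (a * x + b * y)%R * (phi y)%:E)) * (phi x)%:E) =
   \int[leb]_x (f (s * x)%R * (phi x)%:E))%E.
Proof.
move=> b0 s0 sab mf f0.
have mlin (u v : R) : measurable_fun setT (fun x : measurableTypeR R => f (u * x + v)).
  by apply: measurableT_comp => //; exact: measurable_affine.
have mE := (measurable_EFinP _ _).2 mphi.
have f0M (u v : R) : (0 <= f u * (phi v)%:E)%E by rewrite mule_ge0// lee_fin.
(* For b = 0 the change of variable in y degenerates; then s = |a|, and the sign of [a] is absorbed
   by the evenness of the density. *)
have [b00|b1] := eqVneq b 0.
  have E1 (c : R) : (\int[leb]_y (f c * (phi y)%:E) = f c)%E.
    rewrite ge0_integralZl// ?integral_normal_pdf ?mule1//.
    by move=> x _; rewrite lee_fin.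
  transitivity (\int[leb]_x (f (a * x)%R * (phi x)%:E))%E.
    apply: eq_integral => x _; congr (_ * _)%E.
    rewrite -[RHS]E1; apply: eq_integral => y _.
    by rewrite b00 mul0r addr0.
  have sa : s = `|a|.
    by rewrite -(sqrtr_sqr a) -[LHS]ger0_norm// -sqrtr_sqr sab b00 expr0n addr0.
  have [a0|a0] := leP 0 a.
    by rewrite sa ger0_norm.
  rewrite sa ler0_norm 1?ltW//.
  rewrite [LHS]integral_oppr; last 2 first.
  - apply: emeasurable_funM; last exact: mE.
    by have := mlin a 0; under [X in measurable_fun _ X]eq_fun do rewrite addr0.
  - by move=> x; exact: f0M.
  by apply: eq_integral => x _; rewrite normal_pdf01N mulrN mulNr.
have {}b0 : 0 < b by rewrite lt_neqAle eq_sym b1.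
have {}s0 : 0 < s.
  rewrite lt_neqAle s0 andbT eq_sym; apply: contra_eq_neq sab => ->.
  by rewrite expr0n/= lt_eqF// ltr_wpDl ?sqr_ge0// exprn_gt0.
(* The integrand in the variables (x, a x + b y), with [b^-1] as Jacobian. *)
pose G (p : R * R) : \bar R :=
  (f p.2 * (b^-1 * phi p.1 * phi (b^-1 * p.2 - b^-1 * (a * p.1)))%:E)%E.
have G0 p : (0 <= G p)%E.
  by rewrite /G mule_ge0// lee_fin !mulr_ge0// invr_ge0 ltW.
have mG : measurable_fun [set: measurableTypeR R * measurableTypeR R] G.
  apply: emeasurable_funM.
    by apply: measurableT_comp mf _; exact: measurable_snd.
  apply/measurable_EFinP; apply: measurable_funM.
    by apply: measurable_funM => //; apply: (measurableT_comp mphi); exact: measurable_fst.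
  apply: (measurableT_comp mphi); apply: measurable_funB => //.
    by apply: measurable_funM => //; exact: measurable_snd.
  apply: measurable_funM => //; apply: measurable_funM => //; exact: measurable_fst.
transitivity (\int[leb]_x \int[leb]_y G (x, y))%E.
  apply: eq_integral => x _; rewrite /G/=.
  rewrite [RHS](integral_affine (a * x) b0)//; last 2 first.
  - apply: emeasurable_funM => //.
    apply/measurable_EFinP; apply: measurable_funM => //.
    apply: (measurableT_comp mphi).
    by apply: measurable_funB => //; exact: measurable_funM.
  - by move=> y; exact: (G0 (x, y)).
  rewrite -ge0_integralZr//; last 2 first.
  - apply: emeasurable_funM => //.
    by have := mlin b (a * x); under eq_fun do rewrite addrC.
  - by rewrite lee_fin.
  rewrite -ge0_integralZl//; last 3 first.
  - apply: emeasurable_funM; first exact: mlin.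
    apply/measurable_EFinP; apply: measurable_funM => //.
    apply: (measurableT_comp mphi).
    by apply: measurable_funB => //; apply: measurable_funM => //; exact: measurable_affine.
  - by move=> y _; exact: (G0 (x, _)).
  - by rewrite lee_fin ltW.
  apply: eq_integral => y _.
  rewrite -muleA -EFinM muleCA -EFinM addrC; congr (_ * _%:E)%E.
  rewrite !mulrA divff// mul1r mulrC; congr (_ * phi _).
  by field.
transitivity (\int[leb]_y \int[leb]_x G (x, y))%E.
  exact: (@fubini_tonelli _ _ _ _ _ leb leb G).
have sV0 : 0 < s^-1 by rewrite invr_gt0.
rewrite [RHS](integral_affine 0 sV0)//; last first.
  apply: emeasurable_funM => //.
  by have := mlin s 0; under [X in measurable_fun _ X]eq_fun do rewrite addr0.
rewrite -ge0_integralZl//; last 2 first.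
- apply: emeasurable_funM.
    apply: measurableT_comp mf _; apply: measurable_funM => //; exact: measurable_affine.
  by apply/measurable_EFinP; apply: (measurableT_comp mphi); exact: measurable_affine.
- by rewrite lee_fin invr_ge0 ltW.
apply: eq_integral => y _; rewrite /G/= addr0 mulrA divff ?gt_eqF// mul1r.
rewrite ge0_integralZl//; last 2 first.
- apply/measurable_EFinP; apply: measurable_funM; first exact: measurable_funM.
  apply: (measurableT_comp mphi); apply: measurable_funB => //.
  by apply: measurable_funM => //; exact: measurable_funM.
- by move=> x _; rewrite lee_fin !mulr_ge0// invr_ge0 ltW.
rewrite muleCA; congr (_ * _)%E.
under eq_integral do rewrite -mulrA (normal_pdf01_rot _ _ b0 s0 sab) mulrA EFinM.
rewrite ge0_integralZl//; last 3 first.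
- by apply/measurable_EFinP; apply: (measurableT_comp mphi); exact: measurable_affine.
- by move=> x _; rewrite lee_fin.
- by rewrite lee_fin mulr_ge0// invr_ge0 ltW.
(* What is left in x is the normal density after an affine substitution of slope s / b; its total
   mass 1 forces the integral [J] to be b / s. *)
have := @integral_normal_pdf R 0 1.
rewrite (integral_affine (- (a * y / (s * b))) (divr_gt0 s0 b0))//.
set J := integral _ _ _ => J1.
have -> : J = (b / s)%:E.
  rewrite -[LHS]mul1e (_ : 1%E = (b / s)%:E * (s / b)%:E)%E; last first.
    by rewrite -EFinM; congr EFin; field; rewrite b1 gt_eqF.
  by rewrite -muleA J1 mule1.
by rewrite -!EFinM; congr EFin; field; rewrite b1 gt_eqF.
Qed.

(* Rotation invariance of the Lebesgue measure is not needed: the coordinates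
   are merged one at a time. *)
Lemma ge0_integral_gauss_dotp n (a : rvec R n) (f : R -> \bar R) :
  measurable_fun setT f -> (forall x, 0 <= f x)%E ->
  (\int[lebesgue_tuple n]_z (f (dotp a z) * (\prod_(i < n) phi (tnth z i))%:E) =
   \int[leb]_x (f (enorm a * x)%R * (phi x)%:E))%E.
Proof.
elim: n a f => [|n IHn] a f mf f0.
  rewrite /= integral_dirac// ?diracT ?mul1e; last first.
    apply: emeasurable_funM.
      by apply: measurableT_comp => //; exact: measurable_dotp.
    apply/measurable_EFinP; apply: measurable_prod => i _.
    by apply: (measurableT_comp mphi); exact: measurable_tnth.
  rewrite big_ord0 mule1 /enorm /dotp !big_ord0 sqrtr0.
  under eq_integral do rewrite mul0r.
  rewrite ge0_integralZl//; last 2 first.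
  - exact/measurable_EFinP.
  - by move=> x _; rewrite lee_fin.
  by rewrite integral_normal_pdf mule1.
have mprod m : measurable_fun setT (fun z : rvec R m => (\prod_(i < m) phi (tnth z i))%:E).
  apply/measurable_EFinP; apply: measurable_prod => i _.
  by apply: (measurableT_comp mphi); exact: measurable_tnth.
have prod0 m (z : rvec R m) : (0 <= (\prod_(i < m) phi (tnth z i))%:E)%E.
  by rewrite lee_fin; apply: prodr_ge0.
rewrite ge0_integral_lebesgue_tuple; last 2 first.
- apply: emeasurable_funM; last exact: mprod.
  by apply: (measurableT_comp mf); exact: measurable_dotp.
- by move=> z; rewrite mule_ge0.
set a' := (tuncons a).2.
have sab : enorm a ^+ 2 = tnth a ord0 ^+ 2 + enorm a' ^+ 2.
  rewrite /enorm !sqr_sqrtr ?dotpxx_ge0// /dotp big_ord_recl -expr2; congr (_ + _).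
  by apply: eq_bigr => i _; rewrite tnth_tuncons2.
rewrite -(ge0_integral_gauss2 (sqrtr_ge0 _) (sqrtr_ge0 _) sab)//.
apply: eq_integral => x _.
rewrite -(IHn a' (fun t => f (tnth a ord0 * x + t))); last 2 first.
- by apply: (measurableT_comp mf); exact: measurable_funD.
- by move=> t; exact: f0.
rewrite -ge0_integralZr//; last 3 first.
- apply: emeasurable_funM; last exact: mprod.
  apply: (measurableT_comp mf).
  by apply: measurable_funD => //; exact: measurable_dotp.
- by move=> y _; rewrite mule_ge0.
- by rewrite lee_fin.
apply: eq_integral => y _; rewrite dotp_tcons -muleA; congr (_ * _)%E.
rewrite -EFinM big_ord_recl tnth_tcons0 mulrC; congr (_ * _)%:E.
by apply: eq_bigr => i _; rewrite tnth_tconsS.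
Qed.

End GaussianProjection.

(** * Powers of the radius: derivatives, decay and tail integrals *)

Section Radial.
Context {R : realType}.
Local Notation leb := (@lebesgue_measure R).

Lemma measurable_fun_natr_bool d (T : measurableType d) (b : T -> bool) :
  measurable_fun setT b -> measurable_fun setT (fun x => (b x)%:R : R).
Proof.
move=> mb.
rewrite (_ : (fun _ => _) = fun x => if b x then 1 else 0 : R); last first.
  by apply/funext => x; case: (b x).
exact: measurable_fun_ifT.
Qed.

Lemma is_derive_exprn (s : R) n :
  is_derive s 1 (fun x : R => x ^+ n) (n%:R * s ^+ n.-1).
Proof.
have := @is_deriveX R R id n s 1 1 (is_derive_id s 1).
rewrite (_ : id ^+ n = fun x : R => x ^+ n).
  by move=> /is_derive_eq; apply; rewrite /GRing.scale/= mulr1.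
by apply/funext => x; rewrite exprfctE.
Qed.

Lemma cvgy_exprnV n : ((x ^+ n.+1)^-1 : R) @[x --> +oo] --> (0 : R).
Proof.
have V0 : (x^-1 : R) @[x --> +oo] --> (0 : R).
  apply/cvgrVy; first by near=> x; rewrite invr_gt0; near: x; exact: nbhs_pinfty_gt.
  by apply: cvg_trans (@cvg_id _ _); apply: near_eq_cvg; near=> x; rewrite /= invrK.
rewrite (_ : (fun x => _) = (fun x => x ^+ n.+1) \o (fun x => x^-1)); last first.
  by apply/funext => x /=; rewrite exprVn.
apply: (cvg_comp _ _ V0).
have := @exprn_continuous R n.+1 0.
by rewrite /continuous_at expr0n.
Unshelve. all: by end_near. Qed.

Lemma integral_geVX (r : R) n : 0 < r ->
  (\int[leb]_(s in `[r, +oo[) ((s ^+ n.+2)^-1)%:E = (n.+1%:R^-1 * (r ^+ n.+1)^-1)%:E)%E.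
Proof.
move=> r0.
pose F s : R := - (n.+1%:R^-1 * (s ^+ n.+1)^-1).
have dF (s : R) : 0 < s -> is_derive s 1 F ((s ^+ n.+2)^-1).
  move=> s0.
  have sn0 : s ^+ n.+1 != 0 by rewrite expf_neq0// gt_eqF.
  have := is_deriveN (is_deriveM (is_derive_cst (n.+1%:R^-1 : R) s 1)
    (@is_deriveV R (fun x : R => x ^+ n.+1) s _ 1 sn0 (is_derive_exprn s n.+1))).
  move=> /is_derive_eq; apply.
  rewrite scaler0 addr0 /GRing.scale/= mulNr mulrN opprK !exprS.
  by field; rewrite ?gt_eqF ?ltr0n ?exprn_gt0.
apply: etrans (_ : (0%:E - (F r)%:E)%E = _); last first.
  by rewrite -EFinN -EFinD /F opprK add0r.
apply: (@ge0_continuous_FTC2y _ (fun s => (s ^+ n.+2)^-1) F r 0).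
- by move=> x rx; rewrite invr_ge0 exprn_ge0// (le_trans (ltW r0)).
- apply: continuous_in_subspaceT => x; rewrite inE/= in_itv/= andbT => rx.
  apply: cvgV; first by rewrite expf_neq0// gt_eqF// (lt_le_trans r0).
  exact: exprn_continuous.
- rewrite /F -oppr0 -(mulr0 n.+1%:R^-1); apply: cvgN; apply: cvgMl_tmp.
  exact: cvgy_exprnV.
- by move=> x rx; have [] := dF x (lt_trans r0 rx).
- apply: cvg_at_right_filter. have [+ _] := dF _ r0. 
  by move=> /derivable1_diffP/differentiable_continuous.
- move=> x; rewrite in_itv/= andbT => rx.
  by rewrite derive1E; have [_ ->] := dF x (lt_trans r0 rx).
Qed.

End Radial.

(** * Polar coordinates *)

Section Polar.
Context {R : realType} (d : nat).
Local Notation leb := (@lebesgue_measure R).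
Local Notation mu := (@lebesgue_tuple R d.+1).

Lemma measurable_enorm n : measurable_fun [set: rvec R n] enorm.
Proof.
rewrite (_ : enorm = (fun r => r `^ (2^-1)) \o (fun x => dotp x x)); last first.
  by apply/funext => x /=; rewrite powR12_sqrt ?dotpxx_ge0.
apply: measurableT_comp; last exact: measurable_dotpxx.
exact: measurable_powR.
Qed.

Lemma enorm_ge0 n (z : rvec R n) : 0 <= enorm z.
Proof. exact: sqrtr_ge0. Qed.

Lemma enorm_gt0 n (z : rvec R n) : (0 < enorm z) = (0 < dotp z z).
Proof. exact: sqrtr_gt0. Qed.

Lemma dotp_scalet n (a z : rvec R n) c : dotp a (scalet c z) = c * dotp a z.
Proof.
by rewrite /dotp mulr_sumr; apply: eq_bigr => i _; rewrite tnth_mktuple mulrCA.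
Qed.

Lemma normalize_scalet (c : R) (z : rvec R d.+1) : 0 < c ->
  normalize (scalet c z) = normalize z.
Proof.
move=> c0; apply: val_inj.
suff : sphere_val (normalize (scalet c z)) = sphere_val (normalize z) by [].
rewrite !sphere_val_normalize -!enorm_gt0 enorm_scale gtr0_norm// pmulr_rgt0//.
case: ifPn => // z0.
apply: eq_from_tnth => i; rewrite !tnth_mktuple.
by field; rewrite !gt_eqF.
Qed.

Lemma scalet_normalize (z : rvec R d.+1) :
  0 < enorm z -> z = scalet (enorm z) (sphere_val (normalize z)).
Proof.
move=> z0; rewrite sphere_val_normalize -enorm_gt0 z0.
apply: eq_from_tnth => i; rewrite !tnth_mktuple.
by rewrite mulrA divff ?mul1r// gt_eqF.
Qed.

(** At z = 0 [normalize z] is a default point, but the factor [enorm z] vanishes, so the identity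
    holds for every [z]. *)
Lemma dotp_normalize (a z : rvec R d.+1) :
  dotp a z = enorm z * dotp a (sphere_val (normalize z)).
Proof.
have := enorm_ge0 z; rewrite le_eqVlt => /predU1P[z0|z0].
  rewrite -z0 mul0r /dotp big1// => i _.
  have /eqP : dotp z z = 0.
    by apply/eqP; rewrite eq_le dotpxx_ge0 andbT -sqrtr_eq0 -/(enorm z) -z0.
  rewrite psumr_eq0 => [/allP/(_ i)|j _]; last by rewrite -expr2 sqr_ge0.
  by rewrite mem_index_enum /= mulf_eq0 orbb => /(_ isT)/eqP ->; rewrite mulr0.
by rewrite [in LHS](scalet_normalize z0) dotp_scalet.
Qed.

(** The origin is a null set; this gives access to identities that hold only where [normalize] is
    meaningful. *)
Lemma integral_enorm_gt0 (f : rvec R d.+1 -> \bar R) :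
  measurable_fun setT f -> (forall z, 0 <= f z)%E ->
  (\int[mu]_z f z = \int[mu]_z (f z * (0 < enorm z)%R%:R%:E))%E.
Proof.
move=> mf f0.
have mb : measurable_fun [set: rvec R d.+1] (fun z => (0 < enorm z)%R%:R%:E : \bar R).
  apply/measurable_EFinP; apply: measurable_fun_natr_bool.
  by apply: measurable_fun_ltr => //; exact: measurable_enorm.
have m1 : measurable_fun setT (fun z => f z * (0 < enorm z)%R%:R%:E)%E.
  by apply: emeasurable_funM.
have f1 z : (0 <= f z * (0 < enorm z)%R%:R%:E)%E by rewrite mule_ge0.
rewrite [LHS]ge0_integral_lebesgue_tuple// [RHS]ge0_integral_lebesgue_tuple//.
have mI g : measurable_fun [set: rvec R d.+1] g -> (forall z, 0 <= g z)%E ->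
    measurable_fun ([set: measurableTypeR R] `\ 0)
      (fun x => \int[lebesgue_tuple d]_y g (tcons (x, y)))%E.
  by move=> mg g0; apply: measurable_funTS; exact: measurable_fun_int_tcons.
(* Deleting the value 0 of the first coordinate from the outer integral already excludes the
   origin. *)
rewrite -[LHS](@integral_setD1 _ _ 0); last 2 first.
- exact: measurableD.
- exact: mI.
rewrite -[RHS](@integral_setD1 _ _ 0); last 2 first.
- exact: measurableD.
- exact: (mI (fun z => f z * (0 < enorm z)%R%:R%:E)%E).
apply: eq_integral => x; rewrite inE/= => -[_ /= /eqP x0].
apply: eq_integral => y _.
rewrite /enorm sqrtr_gt0 /dotp big_ord_recl tnth_tcons0 -expr2.
rewrite (_ : 0 < _) ?mule1// ltr_pwDl ?exprn_even_gt0//.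
by apply: sumr_ge0 => i _; rewrite -expr2 sqr_ge0.
Qed.

Variables (F : sphere R d -> R) (g : R -> R).
Hypotheses (mF : measurable_fun setT F) (mg : measurable_fun [set: measurableTypeR R] g).
Hypotheses (F0 : forall x, 0 <= F x) (g0 : forall r, 0 <= g r).

Let h (r : R) : R := (0 < r)%R%:R * (r ^+ d * g r).

Let mh : measurable_fun [set: measurableTypeR R] h.
Proof.
apply: measurable_funM.
  by apply: measurable_fun_natr_bool; exact: measurable_fun_ltr.
by apply: measurable_funM => //; exact: measurable_funX.
Qed.

Let h0 r : 0 <= h r.
Proof.
rewrite /h; case: ltP => r0; last by rewrite mul0r.
by rewrite mul1r mulr_ge0// exprn_ge0// ltW.
Qed.

Let mFn : measurable_fun setT (fun z => F (normalize z)).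
Proof. exact: (measurableT_comp mF (@measurable_normalize R d)). Qed.

(* Polar coordinates without surface measure: [H] is integrated over [w, s] in
   both orders. Rescaling [s] separates the radial integral from the integral
   over the unit ball; rescaling [w] turns [H] into [K], whose integral over [s]
   is a multiple of [F (normalize z) * g (enorm z)]. *)
Let H (p : rvec R d.+1 * R) : \bar R :=
  ((enorm p.1 <= 1)%R%:R * F (normalize p.1) * (enorm p.1 * h (enorm p.1 * p.2)))%:E.

Let K (p : rvec R d.+1 * R) : \bar R :=
  ((0 < p.2)%R%:R * (enorm p.1 <= p.2)%R%:R * (p.2 `^ (- d.+2%:R)) *
    (F (normalize p.1) * (enorm p.1 * h (enorm p.1))))%:E.

Let H0 p : (0 <= H p)%E.
Proof.
rewrite lee_fin; apply: mulr_ge0; first exact: mulr_ge0.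
exact: mulr_ge0 (enorm_ge0 _) (h0 _).
Qed.

Let K0 p : (0 <= K p)%E.
Proof.
rewrite lee_fin; apply: mulr_ge0; last first.
  exact: mulr_ge0 (F0 _) (mulr_ge0 (enorm_ge0 _) (h0 _)).
by apply: mulr_ge0; [exact: mulr_ge0|exact: powR_ge0].
Qed.

Let mH : measurable_fun [set: rvec R d.+1 * measurableTypeR R] H.
Proof.
have m1 : measurable_fun [set: rvec R d.+1 * measurableTypeR R] (fun p => enorm p.1).
  exact: (measurableT_comp (@measurable_enorm _)).
apply/measurable_EFinP; apply: measurable_funM; first apply: measurable_funM.
- by apply: measurable_fun_natr_bool; exact: measurable_fun_ler.
- exact: (measurableT_comp mFn).
- apply: measurable_funM => //; apply: (measurableT_comp mh).
  by apply: measurable_funM.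
Qed.

Let mK : measurable_fun [set: rvec R d.+1 * measurableTypeR R] K.
Proof.
have m1 : measurable_fun [set: rvec R d.+1 * measurableTypeR R] (fun p => enorm p.1).
  exact: (measurableT_comp (@measurable_enorm _)).
have m2 : measurable_fun [set: rvec R d.+1 * measurableTypeR R] snd by [].
apply/measurable_EFinP; apply: measurable_funM; first apply: measurable_funM.
- apply: measurable_funM; apply: measurable_fun_natr_bool.
    exact: measurable_fun_ltr.
  exact: measurable_fun_ler.
- exact: (measurableT_comp (measurable_powR _)).
- apply: measurable_funM; first exact: (measurableT_comp mFn).
  by apply: measurable_funM => //; exact: (measurableT_comp mh).
Qed.

(** The substitution r = |w| s has Jacobian |w|, the extra factor [enorm p.1] in [H]. At w = 0 this
    factor kills the integrand, hence the indicator on the right. *)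
Let int_H_s w : (\int[leb]_s H (w, s) =
  ((enorm w <= 1)%R%:R * F (normalize w) * (0 < enorm w)%R%:R)%:E * \int[leb]_r (h r)%:E)%E.
Proof.
rewrite /H/=.
have := enorm_ge0 w; rewrite le_eqVlt => /predU1P[w0|w0].
  under eq_integral do rewrite -w0 mul0r mulr0.
  by rewrite -w0 ltxx mulr0 mul0e integral0.
have hw0 r : (0 <= (h r)%:E)%E by rewrite lee_fin.
under eq_integral do rewrite EFinM.
rewrite ge0_integralZl//; last 3 first.
- apply/measurable_EFinP; apply: measurable_funM => //.
  by apply: (measurableT_comp mh); exact: measurable_funM.
- by move=> s _; rewrite lee_fin mulr_ge0// ltW.
- by rewrite lee_fin mulr_ge0.
rewrite w0 mulr1; congr (_ * _)%E.
rewrite [RHS](integral_affine 0 w0)//; last exact/measurable_EFinP.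
rewrite -ge0_integralZl//; last 2 first.
- apply/measurable_EFinP; apply: (measurableT_comp mh); exact: measurable_affine.
- by rewrite lee_fin ltW.
by apply: eq_integral => s _; rewrite addr0 EFinM.
Qed.

(** Under z = s w the Jacobian is s^(d+1), and |z| = s |w| brings one more factor s; the power
    s^-(d+2) in [K] cancels both. *)
Let int_H_w s : (\int[mu]_w H (w, s) = \int[mu]_z K (z, s))%E.
Proof.
have [s0|s0] := leP s 0.
  rewrite !integral0_eq// => w _; rewrite /H/K/=; first by rewrite ltNge s0 !mul0r.
  by rewrite /h ltNge mulr_ge0_le0 ?enorm_ge0// !mul0r !mulr0.
have mKs : measurable_fun [set: rvec R d.+1] (fun z => K (z, s)).
  exact: (measurableT_comp mK (pair2_measurable s)).
have Ks0 z : (0 <= K (z, s))%E by exact: K0.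
rewrite [RHS](ge0_integral_scalet s0 mKs Ks0) -ge0_integralZl; last 4 first.
- exact: measurableT.
- exact: (measurableT_comp mKs (@measurable_scalet _ _ _)).
- by move=> z _; exact: Ks0.
- by rewrite lee_fin exprn_ge0// ltW.
apply: eq_integral => w _.
rewrite /H/K/= s0 mul1r enorm_scale gtr0_norm// normalize_scalet//.
rewrite -EFinM; congr EFin.
have -> : (s * enorm w <= s) = (enorm w <= 1).
  by rewrite -[X in _ <= X]mulr1 ler_pM2l.
rewrite [enorm w * s]mulrC powR_invn; last exact: ltW.
by rewrite !exprS; field; rewrite expf_neq0// gt_eqF.
Qed.

(** Integrating s^-(d+2) over s >= |z| gives |z|^-(d+1) / (d+1), which cancels the power |z| |z|^d
    contained in [enorm z * h (enorm z)]. *)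
Let int_K_s z : (\int[leb]_s K (z, s) =
  (d.+1%:R^-1)%:E * (F (normalize z) * g (enorm z) * (0 < enorm z)%R%:R)%:E)%E.
Proof.
have := enorm_ge0 z; rewrite le_eqVlt => /predU1P[z0|z0].
  rewrite integral0_eq => [|s _]; first by rewrite -z0 ltxx mulr0 mule0.
  by rewrite /K/= -z0 mul0r !mulr0.
transitivity ((F (normalize z) * (enorm z * h (enorm z)))%:E *
    \int[leb]_(s in `[enorm z, +oo[) ((s ^+ d.+2)^-1)%:E)%E.
  rewrite -ge0_integralZl//.
  - rewrite [RHS]integral_mkcond; apply: eq_integral => s _; rewrite /K/= patchE.
    have [zs|zs] := boolP (s \in `[enorm z, +oo[%classic).
    + move: zs; rewrite inE/= in_itv/= andbT => zs.
      have s0 := lt_le_trans z0 zs.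
      by rewrite s0 zs !mul1r powR_invn 1?ltW// -EFinM mulrC.
    + move: zs; rewrite notin_setE/= in_itv/= andbT => /negP/negbTE ->.
      by rewrite mulr0 !mul0r.
  - apply: (eq_measurable_fun (fun s : measurableTypeR R => (s `^ (- d.+2%:R))%:E)).
      move=> s; rewrite inE/= in_itv/= andbT => zs.
      by rewrite powR_invn// (le_trans (ltW z0)).
    by apply/measurable_funTS/measurable_EFinP; exact: measurable_powR.
  - move=> s /=; rewrite in_itv/= andbT => zs.
    by rewrite lee_fin invr_ge0 exprn_ge0// (le_trans (ltW z0)).
  - by rewrite lee_fin; exact: mulr_ge0 (F0 _) (mulr_ge0 (enorm_ge0 _) (h0 _)).
rewrite integral_geVX// /h z0 -!EFinM; congr EFin.
by rewrite exprS; field; rewrite !gt_eqF// exprn_gt0.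
Qed.

(** The ball integral times d+1 takes the place of the surface integral, since r^d integrates to
    1/(d+1) over [0, 1]. *)
Lemma polar_integral :
  (\int[mu]_z (F (normalize z) * g (enorm z))%:E =
   (d.+1%:R)%:E * \int[leb]_r ((0 < r)%R%:R * (r ^+ d * g r))%:E *
   \int[mu]_w ((enorm w <= 1)%R%:R * F (normalize w))%:E)%E.
Proof.
have mFg : measurable_fun setT (fun z => (F (normalize z) * g (enorm z))%:E).
  apply/measurable_EFinP; apply: measurable_funM => //.
  exact: (measurableT_comp mg (@measurable_enorm _)).
have mB : measurable_fun setT (fun w => ((enorm w <= 1)%R%:R * F (normalize w))%:E).
  apply/measurable_EFinP; apply: measurable_funM => //.
  apply: measurable_fun_natr_bool; apply: measurable_fun_ler => //.
  exact: measurable_enorm.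
have Fg0 z : (0 <= (F (normalize z) * g (enorm z))%:E)%E by rewrite lee_fin mulr_ge0.
have B0 w : (0 <= ((enorm w <= 1)%R%:R * F (normalize w))%:E)%E by rewrite lee_fin mulr_ge0.
have mb : measurable_fun [set: rvec R d.+1] (fun z => (0 < enorm z)%R%:R%:E : \bar R).
  apply/measurable_EFinP; apply: measurable_fun_natr_bool.
  by apply: measurable_fun_ltr => //; exact: measurable_enorm.
rewrite [LHS]integral_enorm_gt0// [X in (_ * X)%E]integral_enorm_gt0//.
have E1 : (\int[mu]_w \int[leb]_s H (w, s) = \int[leb]_s \int[mu]_w H (w, s))%E.
  exact: (@fubini_tonelli _ _ _ _ _ mu leb H).
have E2 : (\int[mu]_w \int[leb]_s K (w, s) = \int[leb]_s \int[mu]_w K (w, s))%E.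
  exact: (@fubini_tonelli _ _ _ _ _ mu leb K).
have E3 : (\int[leb]_s \int[mu]_w H (w, s) = \int[leb]_s \int[mu]_w K (w, s))%E.
  by apply: eq_integral => s _; exact: int_H_w.
move: E1; rewrite E3 -E2.
under eq_integral do rewrite int_H_s EFinM.
under [in RHS]eq_integral do rewrite int_K_s EFinM.
rewrite [LHS]ge0_integralZr; last 4 first.
- exact: measurableT.
- exact: emeasurable_funM mB mb.
- by move=> z _; apply: mule_ge0.
- by apply: integral_ge0 => r _; rewrite lee_fin.
rewrite [RHS]ge0_integralZl; last 4 first.
- exact: measurableT.
- exact: emeasurable_funM mFg mb.
- by move=> z _; apply: mule_ge0.
- by rewrite lee_fin invr_ge0.
rewrite -muleA (muleC (\int[leb]_r (h r)%:E)%E) => ->.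
by rewrite muleA -EFinM divff ?mul1e.
Qed.

End Polar.

Lemma integral_mkbool d (T : measurableType d) (R : realType)
    (mu : {measure set T -> \bar R}) (D : set T) (b : T -> bool) (f : T -> R) :
  (forall x, D x <-> b x) ->
  (\int[mu]_(x in D) (f x)%:E = \int[mu]_x ((b x)%:R * f x)%:E)%E.
Proof.
move=> Db; rewrite integral_mkcond; apply: eq_integral => x _.
rewrite patchE; case: ifPn => [/set_mem/Db ->|]; first by rewrite mul1r.
by rewrite notin_setE => /Db /negP/negbTE ->; rewrite mul0r.
Qed.

(** * Half-line Gaussian moments and Gamma at half-integers *)

Lemma continuous_gauss {R : realType} :
  continuous (fun r : R => expR (- r ^+ 2 / 2)).
Proof.
move=> x; apply: (@continuous_comp _ _ _ (fun x : R => - x ^+ 2 / 2) expR).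
  by apply: cvgMr_tmp; apply: cvgN; exact: exprn_continuous.
exact: continuous_expR.
Qed.

Lemma measurable_gauss {R : realType} : measurable_fun [set: measurableTypeR R]
  (fun r : R => expR (- r ^+ 2 / 2)).
Proof. by apply: continuous_measurable_fun; exact: continuous_gauss. Qed.

Section GaussianMoments.
Context {R : realType}.
Local Notation leb := (@lebesgue_measure R).
Let gf (r : R) : R := expR (- r ^+ 2 / 2).

Let cgf : continuous gf := continuous_gauss.
Let mgf : measurable_fun [set: measurableTypeR R] gf := measurable_gauss.

(** Written with an indicator to match the radial integral of [polar_integral]. For Z standard
    normal in R^(d+1), E |Z|^k is the quotient of [gauss_int (k + d)] by [gauss_int d]. *)
Definition gauss_int (k : nat) : \bar R :=
  (\int[leb]_r ((0 < r)%R%:R * (r ^+ k * expR (- r ^+ 2 / 2)))%:E)%E.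

Lemma gauss_int_itv k :
  gauss_int k = (\int[leb]_(r in `]0%R, +oo[) (r ^+ k * gf r)%:E)%E.
Proof.
rewrite (integral_mkbool _ (b := fun r : measurableTypeR R => (0 : R) < r))// => r.
by rewrite /= in_itv/= andbT.
Qed.

Lemma measurable_gauss_int k : measurable_fun [set: measurableTypeR R]
  (fun r => (0 < r)%R%:R * (r ^+ k * expR (- r ^+ 2 / 2))).
Proof.
apply: measurable_funM.
  by apply: measurable_fun_natr_bool; exact: measurable_fun_ltr.
by apply: measurable_funM => //; exact: measurable_funX.
Qed.

Lemma gauss_int_integrand_ge0 k (r : R) :
  0 <= (0 < r)%R%:R * (r ^+ k * expR (- r ^+ 2 / 2)).
Proof.
case: ltP => r0; last by rewrite mul0r.
by rewrite mul1r mulr_ge0 ?expR_ge0// exprn_ge0// ltW.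
Qed.

Lemma gauss_int_ge0 k : (0 <= gauss_int k)%E.
Proof. by apply: integral_ge0 => r _; rewrite lee_fin gauss_int_integrand_ge0. Qed.

Let dgf (s : R) : is_derive s 1 (fun r => - gf r) (s * gf s).
Proof.
have H : is_derive s 1 (fun x : R => - x ^+ 2 / 2) (- s).
  have := is_deriveM (is_deriveN (is_derive_exprn s 2)) (is_derive_cst (2^-1 : R) s 1).
  by move=> /is_derive_eq; apply; rewrite scaler0 add0r /GRing.scale/=; field.
have := is_deriveN (is_derive1_comp (is_derive_expR _) H).
by move=> /is_derive_eq; apply; rewrite mulrN opprK mulrC.
Qed.

Lemma cvgy_gauss : gf x @[x --> +oo] --> (0 : R).
Proof.
rewrite (_ : gf = (fun y => expR (- y)) \o (fun x => x ^+ 2 / 2)); last first.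
  by apply/funext => x; rewrite /gf/= mulNr.
apply: (cvg_comp (fun x : R => x ^+ 2 / 2) (fun y : R => expR (- y))); last exact: cvgr_expR.
by apply: gt0_cvgMly; [rewrite invr_gt0|exact: cvgr_expr2].
Qed.

Lemma integral_gauss_tail (s : R) : 0 <= s ->
  (\int[leb]_(r in `[s, +oo[) (r * gf r)%:E = (gf s)%:E)%E.
Proof.
move=> s0.
apply: etrans (_ : ((- 0)%:E - (- gf s)%:E)%E = _); last first.
  by rewrite -EFinN -EFinD opprK oppr0 add0r.
apply: (@ge0_continuous_FTC2y _ (fun r => r * gf r) (fun r => - gf r) s (- 0)).
- by move=> x sx; rewrite mulr_ge0 ?expR_ge0// (le_trans s0).
- apply: continuous_subspaceT => x; apply: cvgM; first exact: cvg_id.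
  exact: cgf.
- by apply: cvgN; exact: cvgy_gauss.
- by move=> x _; have [] := dgf x.
- by apply: cvg_at_right_filter; apply: cvgN; exact: cgf.
- by move=> x _; rewrite derive1E; have [_ ->] := dgf x.
Qed.

Lemma integral_exprn (r : R) k : 0 < r ->
  (\int[leb]_(s in `[0%R, r]) (k.+1%:R * s ^+ k)%:E = (r ^+ k.+1)%:E)%E.
Proof.
move=> r0.
rewrite (@continuous_FTC2 _ _ (fun x => x ^+ k.+1))//.
- by rewrite expr0n/= -EFinB subr0.
- apply: continuous_subspaceT => x; apply: cvgM; first exact: cvg_cst.
  exact: exprn_continuous.
- split.
  + by move=> x _; have [] := is_derive_exprn x k.+1.
  + by apply: cvg_at_right_filter; exact: exprn_continuous.
  + by apply: cvg_at_left_filter; exact: exprn_continuous.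
- by move=> x _; rewrite derive1E; have [_ ->] := is_derive_exprn x k.+1.
Qed.

Lemma gauss_int1 : gauss_int 1 = 1%E.
Proof.
rewrite gauss_int_itv integral_itv_obnd_cbnd; last first.
  apply/measurable_funTS/measurable_EFinP; apply: measurable_funM => //.
have := integral_gauss_tail (lexx 0).
by rewrite /gf expr0n/= oppr0 mul0r expR0.
Qed.

(* Tonelli on [0 < s <= r], writing [r ^ (k+1)] as the integral of
   [(k+1) s ^ k] and [exp (- s^2/2)] as a tail integral. *)
Lemma gauss_intSS k : gauss_int k.+2 = (k.+1%:R%:E * gauss_int k)%E.
Proof.
pose h (p : R * R) : \bar R :=
  ((0 < p.1)%R%:R * (p.1 <= p.2)%R%:R * (k.+1%:R * p.1 ^+ k) * (p.2 * gf p.2))%:E.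
have h0 p : (0 <= h p)%E.
  rewrite /h; case: (ltP 0 p.1) => p0; last by rewrite !mul0r.
  case: (leP p.1 p.2) => pq; last by rewrite mulr0 !mul0r.
  rewrite lee_fin !mul1r !mulr_ge0 ?exprn_ge0 ?expR_ge0// ?ltW//.
  exact: lt_le_trans pq.
have mh : measurable_fun [set: measurableTypeR R * measurableTypeR R] h.
  apply/measurable_EFinP; apply: measurable_funM; first apply: measurable_funM.
  - apply: measurable_funM; apply: measurable_fun_natr_bool.
      exact: measurable_fun_ltr.
    exact: measurable_fun_ler.
  - by apply: measurable_funM => //; exact: measurable_funX.
  - by apply: measurable_funM => //; exact: (measurableT_comp mgf).
have E : (\int[leb]_s \int[leb]_r h (s, r) = \int[leb]_r \int[leb]_s h (s, r))%E.
  exact: (@fubini_tonelli _ _ _ _ _ leb leb h).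
transitivity (\int[leb]_r \int[leb]_s h (s, r))%E.
  apply: eq_integral => r _; have [r0|r0] := ltP 0 r; last first.
    rewrite mul0r; apply/esym/integral0_eq => s _; rewrite /h/=.
    have [s0|s0] := ltP 0 s; last by rewrite !mul0r.
    by rewrite [(s <= r)%R]leNgt (le_lt_trans r0 s0) mulr0 !mul0r.
  transitivity ((r * gf r)%:E * \int[leb]_(s in `[0%R, r]) (k.+1%:R * s ^+ k)%:E)%E.
    rewrite (integral_exprn k r0) -EFinM mul1r; congr EFin.
    by rewrite -/(gf r) 2!exprS; ring.
  rewrite -integral_itv_obnd_cbnd; last first.
    by apply/measurable_funTS/measurable_EFinP; apply: measurable_funM.
  rewrite -ge0_integralZl; last 4 first.
  - by [].
  - by apply/measurable_funTS/measurable_EFinP; apply: measurable_funM.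
  - move=> s /=; rewrite in_itv/= => /andP[s0 _].
    by rewrite lee_fin; exact: mulr_ge0 (ler0n _ _) (exprn_ge0 _ (ltW s0)).
  - by rewrite lee_fin; exact: mulr_ge0 (ltW r0) (expR_ge0 _).
  rewrite [LHS](integral_mkbool _
    (b := fun s : measurableTypeR R => ((0 : R) < s) && (s <= r))); last first.
    by move=> s; rewrite /= in_itv; exact: iff_refl.
  apply: eq_integral => s _; rewrite /h [(_, _).1]/= [(_, _).2]/=.
  by rewrite -mulnb natrM; congr EFin; ring.
rewrite -E -ge0_integralZl; last 4 first.
- by [].
- by apply/measurable_EFinP; exact: measurable_gauss_int.
- by move=> r _; rewrite lee_fin gauss_int_integrand_ge0.
- by rewrite lee_fin.
apply: eq_integral => s _; have [s0|s0] := ltP 0 s; last first.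
  rewrite mul0r mule0; apply: integral0_eq => r _; rewrite /h/=.
  by rewrite ltNge s0 !mul0r.
transitivity ((k.+1%:R * s ^+ k)%:E * \int[leb]_(r in `[s, +oo[) (r * gf r)%:E)%E; last first.
  rewrite (integral_gauss_tail (ltW s0)) mul1r -[LHS]EFinM -[RHS]EFinM; congr EFin.
  by rewrite -/(gf s) mulrA.
rewrite -ge0_integralZl; last 4 first.
- by [].
- by apply/measurable_funTS/measurable_EFinP; apply: measurable_funM.
- move=> r /=; rewrite in_itv/= andbT => sr.
  by rewrite lee_fin; exact: mulr_ge0 (le_trans (ltW s0) sr) (expR_ge0 _).
- by rewrite lee_fin; exact: mulr_ge0 (ler0n _ _) (exprn_ge0 _ (ltW s0)).
rewrite [RHS](integral_mkbool _ (b := fun r : measurableTypeR R => (s : R) <= r)); last first.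
  by move=> r; rewrite /= in_itv [X in is_true X <-> _]andbT; exact: iff_refl.
apply: eq_integral => r _; rewrite /h [(_, _).1]/= [(_, _).2]/=.
by rewrite s0 mul1r; congr EFin; ring.
Qed.

Lemma gauss_int0_lty : (gauss_int 0 < +oo)%E.
Proof.
apply: (@le_lt_trans _ _ ((Num.sqrt (pi *+ 2))%:E * \int[leb]_r (normal_pdf 0 1 r)%:E)%E).
  rewrite -ge0_integralZl; last 4 first.
  - by [].
  - by apply/measurable_EFinP; exact: measurable_normal_pdf.
  - by move=> r _; rewrite lee_fin normal_pdf_ge0.
  - by rewrite lee_fin sqrtr_ge0.
  apply: ge0_le_integral.
  - by [].
  - by move=> r _; rewrite lee_fin gauss_int_integrand_ge0.
  - by apply/measurable_EFinP; exact: measurable_gauss_int.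
  - apply/measurable_EFinP; apply: measurable_funM => //.
    exact: measurable_normal_pdf.
  - move=> r _; rewrite -EFinM lee_fin normal_pdf01E mulVKf; last first.
      by rewrite gt_eqF// sqrtr_gt0 mulrn_wgt0// pi_gt0.
    by rewrite expr0 mul1r; case: (ltP 0 r) => _; rewrite ?mul1r ?mul0r ?expR_ge0.
by rewrite integral_normal_pdf mule1 ltry.
Qed.

Lemma gauss_int0_gt0 : (0 < gauss_int 0)%E.
Proof.
apply: (@lt_le_trans _ _ ((expR (- 2^-1))%:E * \int[leb]_r (\1_(`]0%R, 1%R] : set R) r)%:E)%E).
  rewrite integral_indic// setIT [X in (_ * X)%E]lebesgue_measure_itv/= lte01.
  by rewrite oppr0 adde0 mule1 lte_fin expR_gt0.
rewrite -ge0_integralZl; last 4 first.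
- by [].
- by apply/measurable_EFinP; exact: measurable_indic.
- by move=> r _; rewrite lee_fin.
- by rewrite lee_fin expR_ge0.
apply: ge0_le_integral.
- by [].
- by move=> r _; rewrite mule_ge0// lee_fin ?expR_ge0.
- by apply/measurable_EFinP; apply: measurable_funM => //; exact: measurable_indic.
- by apply/measurable_EFinP; exact: measurable_gauss_int.
move=> r _; rewrite -EFinM lee_fin indicE.
case: (boolP (r \in _)) => [|_]; last by rewrite mulr0 gauss_int_integrand_ge0.
rewrite inE/= in_itv/= => /andP[r0 r1]; rewrite r0 !mul1r mulr1 ler_expR.
by rewrite mulNr lerN2 ler_pdivrMr// mulVf// expr_le1// ltW.
Qed.

Lemma gauss_int_fin_gt0 k : (gauss_int k \is a fin_num) && (0 < gauss_int k)%E.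
Proof.
(* The recursion has step two, so the induction carries two consecutive indices. *)
suff : (gauss_int k \is a fin_num) && (0 < gauss_int k)%E /\
       (gauss_int k.+1 \is a fin_num) && (0 < gauss_int k.+1)%E by case.
elim: k => [|k [/andP[f1 p1] ->]]; split => //.
- rewrite gauss_int0_gt0 andbT ge0_fin_numE ?gauss_int_ge0//.
  exact: gauss_int0_lty.
- by rewrite gauss_int1 lte01.
- by rewrite gauss_intSS fin_numM//= mule_gt0// lte_fin.
Qed.

Definition gaussR k : R := fine (gauss_int k).

Lemma gauss_intE k : gauss_int k = (gaussR k)%:E.
Proof. by rewrite fineK//; have /andP[] := gauss_int_fin_gt0 k. Qed.

Lemma gaussR_gt0 k : 0 < gaussR k.
Proof.
by rewrite -lte_fin -gauss_intE; have /andP[] := gauss_int_fin_gt0 k.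
Qed.

Lemma gaussRSS k : gaussR k.+2 = k.+1%:R * gaussR k.
Proof. by rewrite /gaussR gauss_intSS gauss_intE. Qed.

End GaussianMoments.

Section GammaHalfIntegers.
Context {R : realType}.
Local Notation leb := (@lebesgue_measure R).

Lemma bigcup_itvcy_gt0 (a : R^nat) : (forall n, 0 < a n) ->
  a n @[n --> \oo] --> (0 : R) ->
  \bigcup_n `[a n, +oo[%classic = `]0, +oo[%classic.
Proof.
move=> a0 acvg; apply/seteqP; split => t /=.
  by move=> [n _] /=; rewrite !in_itv/= !andbT; exact: lt_le_trans.
rewrite in_itv/= andbT => t0.
have /cvgrPdist_lt/(_ _ t0)[n _ /(_ n (leqnn n))] := acvg.
rewrite sub0r normrN gtr0_norm// => ant.
by exists n => //=; rewrite in_itv/= andbT ltW.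
Qed.

(** Lets a substitution that is available on [a, +oo[ for each a > 0 reach the open half-line. *)
Lemma cvg_integral_itvcy (a : R^nat) (f : R -> R) : (forall n, 0 < a n) ->
  a n @[n --> \oo] --> (0 : R) -> nonincreasing_seq a ->
  measurable_fun (`]0%R, +oo[%classic : set (measurableTypeR R)) f ->
  (forall t, 0 < t -> 0 <= f t) ->
  (\int[leb]_(t in `[a n, +oo[) (f t)%:E)%E @[n --> \oo] -->
  (\int[leb]_(t in `]0%R, +oo[) (f t)%:E)%E.
Proof.
move=> a0 acvg nia mf f0; rewrite -(bigcup_itvcy_gt0 a0 acvg).
apply: ge0_nondecreasing_set_cvg_integral.
- move=> m n mn; rewrite subsetEset => t /=; rewrite !in_itv/= !andbT.
  by apply: le_trans; exact: nia.
- by move=> n; exact: measurable_itv.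
- move=> n; apply/measurable_EFinP; apply: measurable_funS mf => // t /=.
  by rewrite !in_itv/= !andbT; exact: lt_le_trans.
- move=> n t /=; rewrite in_itv/= andbT => nt.
  by rewrite lee_fin f0// (lt_le_trans (a0 n)).
Qed.

Let gf (r : R) : R := expR (- r ^+ 2 / 2).
(** The substitution r = sqrt (2 t), which turns exp (- r^2/2) into exp (- t) and satisfies F' = 1 /
    F. *)
Let F (t : R) : R := Num.sqrt (2 * t).
Let G k (t : R) : R := t `^ (k.+1%:R / 2 - 1) * expR (- t).

Let dF (t : R) : 0 < t -> is_derive t 1 F (F t)^-1.
Proof.
move=> t0.
have t20 : 0 < 2 * t by rewrite mulr_gt0.
have := is_derive1_comp (is_derive1_sqrt t20)
  (is_deriveM (is_derive_cst (2 : R) t 1) (is_derive_id t 1)).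
by move=> /is_derive_eq; apply; rewrite scaler0 addr0 /GRing.scale/= mulr1 /F; field;
  rewrite gt_eqF// sqrtr_gt0.
Qed.

Let F_continuous : continuous F.
Proof.
move=> t; apply: (@continuous_comp _ _ _ (fun x : R => 2 * x) Num.sqrt).
  by apply: cvgMl_tmp; exact: cvg_id.
exact: sqrt_continuous.
Qed.

Let cvgy_F : F t @[t --> +oo] --> +oo.
Proof.
apply/cvgryPge => A; near=> t.
have A1 : 0 < `|A| + 1 by rewrite ltr_wpDl.
apply: (@le_trans _ _ (`|A| + 1)); first by rewrite (le_trans (ler_norm A))// lerDl.
rewrite -[leLHS]gtr0_norm// -sqrtr_sqr ler_wsqrtr//.
rewrite -ler_pdivrMl//; near: t; exact: nbhs_pinfty_ge.
Unshelve. all: by end_near. Qed.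

Let cgf : continuous gf := continuous_gauss.

Let sqrt_powR (t : R) k : 0 < t ->
  F t ^+ k * (F t)^-1 = 2 `^ ((k%:R - 1) / 2) * t `^ (k.+1%:R / 2 - 1).
Proof.
move=> t0; have t20 : 0 < 2 * t by rewrite mulr_gt0.
have F0 : 0 < F t by rewrite sqrtr_gt0.
rewrite -[(F t)^-1]powR_inv1 1?ltW// -[F t ^+ k]powR_mulrn 1?ltW//.
rewrite -powRD; last by rewrite (gt_eqF F0) implybT.
rewrite {1}/F -powR12_sqrt 1?ltW// -powRrM.
rewrite (_ : 2^-1 * (k%:R - 1) = (k%:R - 1) / 2); last by field.
rewrite powRM 1?ltW//; congr (_ * _ `^ _).
by rewrite -natr1; field.
Qed.

(* Away from 0, since for [k = 0] the integrand [G k] is singular at 0. *)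
Let integral_sqrt_subst (a : R) k : 0 < a ->
  (\int[leb]_(r in `[F a, +oo[) (r ^+ k * gf r)%:E =
   (2 `^ ((k%:R - 1) / 2))%:E * \int[leb]_(t in `[a, +oo[) (G k t)%:E)%E.
Proof.
move=> a0.
have F'E (t : R) : 0 < t -> derive1 F t = (F t)^-1.
  by move=> t0; rewrite derive1E; have [_ ->] := dF t0.
have cV (t : R) : 0 < t -> (F x)^-1 @[x --> t] --> (F t)^-1.
  move=> t0; apply: cvgV; last exact: F_continuous.
  by rewrite gt_eqF// sqrtr_gt0 mulr_gt0.
rewrite (@increasing_ge0_integration_by_substitutiony R F (fun r => r ^+ k * gf r) a).
- rewrite -ge0_integralZl; last 4 first.
  + exact: measurable_itv.
  + apply/measurable_funTS/measurable_EFinP; apply: measurable_funM.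
      exact: measurable_powR.
    by apply: measurableT_comp => //; exact: measurableT_comp.
  + by move=> t _; rewrite lee_fin mulr_ge0 ?powR_ge0 ?expR_ge0.
  + by rewrite lee_fin powR_ge0.
  apply: eq_integral => t; rewrite inE/= in_itv/= andbT => at_.
  have t0 := lt_le_trans a0 at_.
  have t20 : 0 < 2 * t by rewrite mulr_gt0.
  rewrite -EFinM; congr EFin.
  transitivity ((F t ^+ k * gf (F t)) * derive1 F t); first by [].
  rewrite F'E// mulrAC sqrt_powR// /G mulrA /gf /F sqr_sqrtr 1?ltW//.
  by congr (_ * expR _); field.
- move=> x y; rewrite !in_itv/= !andbT => ax ay xy.
  by rewrite ltr_sqrt ?ltr_pM2l// mulr_gt0// (lt_le_trans a0).
- move=> t; rewrite in_itv/= andbT => at_.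
  have t0 := lt_trans a0 at_.
  rewrite /continuous_at F'E//; apply: cvg_trans (cV _ t0).
  apply: near_eq_cvg; near=> x; rewrite F'E//; near: x.
  exact: lt_nbhsr.
- apply/cvg_ex; exists (F a)^-1.
  apply: cvg_trans (cvg_at_right_filter (cV _ a0)).
  apply: near_eq_cvg; near=> x; rewrite F'E//; rewrite (lt_trans a0)//.
- apply/cvg_ex; exists 0.
  apply: (@cvg_trans _ ((F x)^-1 @[x --> +oo])).
    by apply: near_eq_cvg; near=> x; rewrite F'E.
  apply/gtr0_cvgV0; last exact: cvgy_F.
  by near=> x; rewrite sqrtr_gt0 mulr_gt0.
- split; last exact/cvg_at_right_filter/F_continuous.
  move=> x; rewrite in_itv/= andbT => ax.
  by have [] := dF (lt_trans a0 ax).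
- exact: cvgy_F.
- apply: continuous_subspaceT => x; apply: cvgM; first exact: exprn_continuous.
  exact: cgf.
- move=> r; rewrite in_itv/= andbT => ar.
  rewrite mulr_ge0 ?expR_ge0// exprn_ge0//.
  by rewrite (le_trans _ (ltW ar))// sqrtr_ge0.
Unshelve. all: by end_near. Qed.

(** The substitution r = sqrt (2 t) relates the two integrals truncated at [a n]; both truncations
    converge as [a n] tends to 0, and limits are unique. Positivity and the functional equation of
    [Gamma] at half-integers are inherited from [gaussR]. *)
Lemma Gamma_half_int k :
  Gamma (k.+1%:R / 2 : R) = 2 `^ ((1 - k%:R) / 2) * gaussR k.
Proof.
pose a n : R := n.+1%:R^-1.
have a0 n : 0 < a n by rewrite invr_gt0.
have acvg : a n @[n --> \oo] --> (0 : R) by exact: cvg_harmonic.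
have nia : nonincreasing_seq a.
  by move=> m n mn; rewrite lef_pV2 ?posrE// ler_nat.
have Fa0 n : 0 < F (a n) by rewrite sqrtr_gt0 mulr_gt0.
have Facvg : F (a n) @[n --> \oo] --> (0 : R).
  rewrite (_ : 0 = F 0); last by rewrite /F mulr0 sqrtr0.
  by apply: (cvg_comp _ _ acvg); exact: F_continuous.
have Fnia : nonincreasing_seq (F \o a).
  by move=> m n mn; rewrite /= ler_wsqrtr// ler_pM2l//; exact: nia.
have mG : measurable_fun [set: measurableTypeR R] (G k).
  apply: measurable_funM; first exact: measurable_powR.
  by apply: measurableT_comp => //; exact: measurableT_comp.
have mrg : measurable_fun [set: measurableTypeR R] (fun r => r ^+ k * gf r).
  apply: measurable_funM; first exact: measurable_funX.
  exact: continuous_measurable_fun cgf.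
have c1 := cvg_integral_itvcy a0 acvg nia (measurable_funTS mG)
  (fun t _ => mulr_ge0 (powR_ge0 t _) (expR_ge0 _)).
have c2 := cvg_integral_itvcy Fa0 Facvg Fnia (measurable_funTS mrg)
  (fun r r0 => mulr_ge0 (exprn_ge0 k (ltW r0)) (expR_ge0 _)).
rewrite -gauss_int_itv gauss_intE in c2.
have E : (\int[leb]_(t in `]0%R, +oo[) (G k t)%:E =
    (2 `^ ((1 - k%:R) / 2))%:E * (gaussR k)%:E)%E.
  have c3 := cvgeZl (isT : (2 `^ ((1 - k%:R) / 2))%:E \is a fin_num) c2.
  apply: cvg_unique c1 _ => //; apply: cvg_trans c3; apply: near_eq_cvg.
  near=> n; rewrite /= (integral_sqrt_subst k (a0 n)) muleA -EFinM.
  rewrite -powRD; last by rewrite pnatr_eq0 implybT.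
  rewrite (_ : (1 - k%:R) / 2 + (k%:R - 1) / 2 = 0 :> R); last by field.
  by rewrite powRr0 mul1e.
by rewrite /Gamma /Rintegral E.
Unshelve. all: by end_near. Qed.

End GammaHalfIntegers.

(** * The uniform distribution on the sphere *)

Section UniformSphere.
Context {R : realType} (d : nat).
Local Notation mu := (@lebesgue_tuple R d.+1).
Local Notation leb := (@lebesgue_measure R).
Local Notation peak := ((Num.sqrt (pi *+ 2))^-1 : R).

Lemma peak_gt0 : 0 < peak.
Proof. by rewrite invr_gt0 sqrtr_gt0 mulrn_wgt0// pi_gt0. Qed.

Lemma enorm_sqr n (z : rvec R n) : enorm z ^+ 2 = dotp z z.
Proof. by rewrite /enorm sqr_sqrtr ?dotpxx_ge0. Qed.

Lemma prod_normal_pdf01 n (z : rvec R n) :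
  \prod_(i < n) normal_pdf 0 1 (tnth z i) = peak ^+ n * expR (- enorm z ^+ 2 / 2).
Proof.
under eq_bigr do rewrite normal_pdf01E.
rewrite big_split/= prodr_const card_ord -expR_sum; congr (_ * expR _).
by rewrite enorm_sqr /dotp -sumrN mulr_suml; apply: eq_bigr => i _; rewrite expr2.
Qed.

Lemma measurable_gauss_enorm n : measurable_fun [set: rvec R n]
  (fun z => expR (- enorm z ^+ 2 / 2)).
Proof.
apply: measurableT_comp => //; apply: measurable_funM => //.
apply: measurableT_comp => //; apply: measurable_funX; exact: measurable_enorm.
Qed.

(** The projection formula with the constant function 1, where the vector [a] is irrelevant and
    taken to be 0. *)
Lemma integral_gauss_enorm n :
  (\int[lebesgue_tuple n]_z (expR (- enorm z ^+ 2 / 2))%:E = (peak ^- n)%:E)%E.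
Proof.
have := @ge0_integral_gauss_dotp R n [tuple 0 | i < n] (cst 1%E)
  (measurable_cst _) (fun=> lee01).
under [RHS]eq_integral do rewrite mul1e.
rewrite integral_normal_pdf.
under eq_integral do rewrite mul1e prod_normal_pdf01 EFinM.
rewrite ge0_integralZl; last 4 first.
- exact: measurableT.
- by apply/measurable_EFinP; exact: measurable_gauss_enorm.
- by move=> z _; rewrite lee_fin expR_ge0.
- by rewrite lee_fin exprn_ge0// ltW// peak_gt0.
move=> E; rewrite -[RHS]mule1 -E muleA -EFinM mulVf ?mul1e//.
by rewrite expf_neq0// gt_eqF// peak_gt0.
Qed.

(** The volume of the unit ball as polar coordinates deliver it: the Gaussian integral peak^-(d+1)
    is (d+1) [gaussR d] times that volume. *)
Let vol : R := (peak ^+ d.+1 * d.+1%:R * gaussR d)^-1.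

Let vol_gt0 : 0 < vol.
Proof. by rewrite invr_gt0 !mulr_gt0 ?exprn_gt0 ?peak_gt0 ?gaussR_gt0. Qed.

Lemma unit_ball_indic n (w : rvec R n) : \1_(@unit_ball R n) w = (enorm w <= 1)%R%:R :> R.
Proof.
rewrite indicE; congr (nat_of_bool _)%:R; apply/idP/idP; first by move/set_mem.
by move=> w1; apply/mem_set.
Qed.

Lemma lebesgue_unit_ball : mu (@unit_ball R d.+1) = vol%:E.
Proof.
have := @polar_integral R d (cst 1) (fun r => expR (- r ^+ 2 / 2))
  (measurable_cst _) measurable_gauss (fun=> ler01) (fun=> expR_ge0 _).
under eq_integral do rewrite mul1r.
rewrite integral_gauss_enorm -/(gauss_int d) gauss_intE.
under [X in (_ * X)%E]eq_integral do rewrite mulr1.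
have -> : (\int[mu]_w ((enorm w <= 1)%R%:R%:E : \bar R) = mu (@unit_ball R d.+1))%E.
  rewrite -[in RHS](setIT (@unit_ball R d.+1)) -integral_indic//; last first.
    exact: measurable_unit_ball.
  by apply: eq_integral => w _; rewrite unit_ball_indic.
move=> E.
rewrite -[LHS]mul1e (_ : 1%E = (vol * peak ^+ d.+1)%:E * (d.+1%:R * gaussR d)%:E)%E.
  rewrite -muleA [(d.+1%:R * _)%:E]EFinM -E -EFinM; congr EFin.
  by rewrite mulfK// expf_neq0// gt_eqF// peak_gt0.
rewrite -EFinM -[vol * _ * _]mulrA (mulrA (peak ^+ _)) mulVf// gt_eqF//.
by rewrite -invr_gt0 vol_gt0.
Qed.

Lemma ge0_integral_unif_sphere (F : sphere R d -> R) :
  measurable_fun setT F -> (forall x, 0 <= F x) ->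
  (\int[unif_sphere d]_x (F x)%:E =
   vol^-1%:E * \int[mu]_w ((enorm w <= 1)%R%:R * F (normalize w))%:E)%E.
Proof.
move=> mF F0; rewrite /unif_sphere.
have mFn : measurable_fun setT (fun z => F (normalize z)).
  exact: (measurableT_comp mF (@measurable_normalize R d)).
have mb : measurable_fun setT (fun w : rvec R d.+1 => (enorm w <= 1)%R%:R : R).
  apply: measurable_fun_natr_bool; apply: measurable_fun_ler => //.
  exact: measurable_enorm.
rewrite [LHS]ge0_integral_pushforward; last 4 first.
- exact: measurable_normalize.
- exact: measurableT.
- exact/measurable_EFinP.
- by move=> x _; rewrite lee_fin.
rewrite (@ge0_integral_density _ _ _ mu _ (fun w => vol^-1 * (enorm w <= 1)%R%:R)); last 5 first.
- exact: measurable_funM.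
- by move=> w; rewrite mulr_ge0// invr_ge0 ltW.
- move=> A mA.
  have mrT : mrestr mu (@measurable_unit_ball R d.+1) setT = vol%:E.
    by rewrite /mrestr setTI lebesgue_unit_ball.
  (* The volume being positive and finite, [mnormalize] divides by it and its default branch is
     ruled out. *)
  rewrite [LHS](_ : _ = mu (A `&` @unit_ball R d.+1) * vol^-1%:E)%E; last first.
    rewrite /= /mnormalize [X in fine X]mrT [X in X == 0%E]mrT.
    rewrite [X in X == +oo%E]mrT ifF//.
    by rewrite eqe gt_eqF// orbF; apply/eqP.
  under [RHS]eq_integral do rewrite -unit_ball_indic EFinM.
  rewrite ge0_integralZl; last 4 first.
  - exact: mA.
  - by apply/measurable_EFinP/measurable_indic; exact: measurable_unit_ball.
  - by move=> w _; rewrite lee_fin.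
  - by rewrite lee_fin invr_ge0 ltW.
  by rewrite integral_indic// 1?setIC 1?muleC//; exact: measurable_unit_ball.
- exact/measurable_EFinP.
- by move=> w; rewrite lee_fin.
rewrite -ge0_integralZl; last 4 first.
- exact: measurableT.
- by apply/measurable_EFinP; exact: measurable_funM.
- by move=> w _; rewrite lee_fin mulr_ge0.
- by rewrite lee_fin invr_ge0 ltW.
by apply: eq_integral => w _; rewrite -!EFinM /= mulrC mulrA.
Qed.

(** The factor d+1 and the volume of the ball combine to the inverse of peak^(d+1) [gaussR d]. *)
Lemma polar_integral_unif (F : sphere R d -> R) (g : R -> R) :
  measurable_fun setT F -> measurable_fun [set: measurableTypeR R] g ->
  (forall x, 0 <= F x) -> (forall r, 0 <= g r) ->
  (\int[mu]_z (F (normalize z) * g (enorm z))%:E =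
   (peak ^+ d.+1 * gaussR d)^-1%:E *
   \int[leb]_r ((0 < r)%R%:R * (r ^+ d * g r))%:E *
   \int[unif_sphere d]_x (F x)%:E)%E.
Proof.
move=> mF mg F0 g0; rewrite polar_integral// ge0_integral_unif_sphere//.
rewrite [RHS]muleA; congr (_ * _)%E; rewrite muleAC -EFinM; congr (_%:E * _)%E.
rewrite /vol invrK mulrAC mulKf//.
by rewrite gt_eqF// mulr_gt0 ?exprn_gt0 ?gaussR_gt0 ?peak_gt0.
Qed.

End UniformSphere.

Lemma mule_eqI (R : realType) (a : R) (x y : \bar R) : a != 0 ->
  (a%:E * x = a%:E * y)%E -> x = y.
Proof.
move=> a0 E; rewrite -[LHS]mul1e -[RHS]mul1e (_ : 1%E = a^-1%:E * a%:E)%E.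
  by rewrite -!muleA E.
by rewrite -EFinM mulVf.
Qed.

Lemma mule_eqV (R : realType) (a : R) (x y : \bar R) : a != 0 ->
  (a%:E * x = y)%E -> x = (a^-1%:E * y)%E.
Proof. by move=> a0 <-; rewrite muleA -EFinM mulVf// mul1e. Qed.

Lemma peak_neq0 (R : realType) : ((Num.sqrt (pi *+ 2))^-1 : R) != 0.
Proof. by rewrite gt_eqF ?peak_gt0. Qed.

(** * Homogeneous functions of eta . x under the uniform law *)

Section SphereMoments.
Context {R : realType} (d : nat) (eta : sphere R d).
Local Notation mu := (@lebesgue_tuple R d.+1).
Local Notation leb := (@lebesgue_measure R).
Local Notation U := (@unif_sphere R d).
Local Notation peak := ((Num.sqrt (pi *+ 2))^-1 : R).
Let u (x : sphere R d) : R := dotp (sphere_val eta) (sphere_val x).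

Lemma enorm_sphere (x : sphere R d) : enorm (sphere_val x) = 1.
Proof. by case: x => x /= /eqP. Qed.

Lemma measurable_sphere_val : measurable_fun [set: sphere R d] (@sphere_val R d).
Proof. by move=> _ A mA; rewrite setTI; exists A => //; rewrite setTI. Qed.

Lemma measurable_sphere_dotp : measurable_fun [set: sphere R d] u.
Proof. exact: (measurableT_comp (measurable_dotp _) measurable_sphere_val). Qed.

(** Cauchy-Schwarz for unit vectors, read off |eta + x|^2 >= 0 and |eta - x|^2 >= 0. *)
Lemma sphere_dotp_bound x : -1 <= u x <= 1.
Proof.
have dE (y : sphere R d) : dotp (sphere_val y) (sphere_val y) = 1.
  by rewrite -enorm_sqr enorm_sphere expr1n.
have E1 : 0 <= \sum_(i < d.+1) (tnth (sphere_val eta) i + tnth (sphere_val x) i) ^+ 2.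
  by apply: sumr_ge0 => i _; exact: sqr_ge0.
have E2 : 0 <= \sum_(i < d.+1) (tnth (sphere_val eta) i - tnth (sphere_val x) i) ^+ 2.
  by apply: sumr_ge0 => i _; exact: sqr_ge0.
have S1 : \sum_(i < d.+1) (tnth (sphere_val eta) i + tnth (sphere_val x) i) ^+ 2 =
    2 + 2 * u x.
  transitivity (dotp (sphere_val eta) (sphere_val eta) +
      dotp (sphere_val x) (sphere_val x) + 2 * u x); last by rewrite !dE; ring.
  rewrite /u /dotp mulr_sumr -!big_split/=.
  by apply: eq_bigr => i _; ring.
have S2 : \sum_(i < d.+1) (tnth (sphere_val eta) i - tnth (sphere_val x) i) ^+ 2 =
    2 - 2 * u x.
  transitivity (dotp (sphere_val eta) (sphere_val eta) +
      dotp (sphere_val x) (sphere_val x) - 2 * u x); last by rewrite !dE; ring.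
  rewrite /u /dotp mulr_sumr -sumrN -!big_split/=.
  by apply: eq_bigr => i _; ring.
by move: E1 E2; rewrite S1 S2 => E1 E2; apply/andP; split; lra.
Qed.

(** For Z standard normal, |Z| and Z/|Z| separate: E f(eta . Z) = E |Z|^k E f(u), and eta . Z is
    standard normal on the line. The quotient of [gaussR] values is 1 / E |Z|^k. *)
Lemma integral_unif_homogeneous (f : R -> R) k :
  measurable_fun [set: measurableTypeR R] f -> (forall y, 0 <= f y) ->
  (forall c y, 0 < c -> f (c * y) = c ^+ k * f y) ->
  (\int[U]_x (f (u x))%:E = (peak * gaussR d / gaussR (k + d))%:E *
    \int[leb]_x (f x * expR (- x ^+ 2 / 2))%:E)%E.
Proof.
move=> mf f0 fM.
(* The indicator keeps [g] nonnegative on negative reals, where an odd power is not. *)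
pose g (r : R) : R := (0 <= r)%R%:R * (r ^+ k * expR (- r ^+ 2 / 2)).
have g0 r : 0 <= g r.
  rewrite /g; case: (leP 0 r) => r0; last by rewrite mul0r.
  by rewrite mul1r mulr_ge0 ?expR_ge0// exprn_ge0.
have mg : measurable_fun [set: measurableTypeR R] g.
  apply: measurable_funM; first by apply: measurable_fun_natr_bool; exact: measurable_fun_ler.
  by apply: measurable_funM; [exact: measurable_funX|exact: measurable_gauss].
have mfu : measurable_fun [set: sphere R d] (f \o u).
  exact: (measurableT_comp mf measurable_sphere_dotp).
have := polar_integral_unif mfu mg (fun x => f0 _) g0.
have -> : (\int[leb]_r ((0 < r)%R%:R * (r ^+ d * g r))%:E = (gaussR (k + d))%:E)%E.
  rewrite -gauss_intE; apply: eq_integral => r _; congr EFin; rewrite /g.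
  have [r0|r0] := ltP 0 r; last by rewrite !mul0r.
  by rewrite (ltW r0) !mul1r exprD; ring.
have -> : (\int[mu]_z ((f \o u) (normalize z) * g (enorm z))%:E =
    (peak ^- d)%:E * \int[leb]_x (f x * expR (- x ^+ 2 / 2))%:E)%E.
  have mfd : measurable_fun setT (fun z => f (dotp (sphere_val eta) z) : R).
    exact: (measurableT_comp mf (measurable_dotp _)).
  have mfe : measurable_fun setT
      (fun z => (f (dotp (sphere_val eta) z) * expR (- enorm z ^+ 2 / 2))%:E).
    by apply/measurable_EFinP; apply: measurable_funM => //; exact: measurable_gauss_enorm.
  have mfn : measurable_fun setT (fun z => ((f \o u) (normalize z) * g (enorm z))%:E).
    apply/measurable_EFinP; apply: measurable_funM.
      exact: (measurableT_comp mfu (@measurable_normalize R d)).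
    exact: (measurableT_comp mg (@measurable_enorm _ _)).
  have mEf : measurable_fun [set: measurableTypeR R] (EFin \o f) by exact/measurable_EFinP.
  have := @ge0_integral_gauss_dotp R _ (sphere_val eta) (EFin \o f) mEf
    (fun y => f0 y).
  rewrite enorm_sphere => H.
  (* Homogeneity turns |z|^k f(u) into f(eta . z); it is assumed for positive scalings, so the
     origin is removed first. *)
  transitivity (\int[mu]_z (f (dotp (sphere_val eta) z) * expR (- enorm z ^+ 2 / 2))%:E)%E.
    rewrite [LHS]integral_enorm_gt0; last 2 first.
    - exact: mfn.
    - by move=> z; rewrite lee_fin mulr_ge0//; exact: f0.
    rewrite [RHS]integral_enorm_gt0; last 2 first.
    - exact: mfe.
    - by move=> z; rewrite lee_fin mulr_ge0// ?expR_ge0.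
    apply: eq_integral => z _.
    have [z0|_] := ltP 0 (enorm z); last by rewrite !mule0.
    congr (_%:E * _)%E.
    rewrite /g (ltW z0) mul1r [dotp _ z]dotp_normalize fM// -/(u _) [(f \o u) _]/=.
    by rewrite mulrA [f _ * _]mulrC.
  apply: (@mule_eqV _ (peak ^+ d)); first by rewrite expf_neq0// peak_neq0.
  (* The density on R^(d+1) takes d+1 factors [peak] and the one on the line takes one, whence
     peak^-d in the claim. *)
  apply: (mule_eqI (peak_neq0 R)); rewrite muleA -EFinM -exprS.
  rewrite -[in LHS]ge0_integralZl; last 4 first.
  - exact: measurableT.
  - exact: mfe.
  - by move=> z _; rewrite lee_fin mulr_ge0 ?expR_ge0.
  - by rewrite lee_fin exprn_ge0// ltW// peak_gt0.
  rewrite -[in RHS]ge0_integralZl; last 4 first.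
  - exact: measurableT.
  - by apply/measurable_EFinP; apply: measurable_funM => //; exact: measurable_gauss.
  - by move=> z _; rewrite lee_fin mulr_ge0 ?expR_ge0.
  - by rewrite lee_fin ltW// peak_gt0.
  transitivity (\int[mu]_z ((EFin \o f) (dotp (sphere_val eta) z) *
       (\prod_(i < d.+1) normal_pdf 0 1 (tnth z i))%:E))%E.
    apply: eq_integral => z _; rewrite prod_normal_pdf01 -[LHS]EFinM -[RHS]EFinM.
    by congr EFin; ring.
  rewrite H; apply: eq_integral => x _; rewrite mul1r normal_pdf01E -[LHS]EFinM -[RHS]EFinM.
  by congr EFin; ring.
move=> E; apply: (@mule_eqI _ ((peak ^+ d.+1 * gaussR d)^-1 * gaussR (k + d))).
  by rewrite mulf_neq0 ?invr_eq0 ?mulf_neq0 ?expf_neq0 ?peak_neq0 ?gt_eqF ?gaussR_gt0.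
rewrite EFinM -E muleA -EFinM; congr (_%:E * _)%E.
have p0 := peak_neq0 R; have g1 : gaussR d != 0 :> R by rewrite gt_eqF ?gaussR_gt0.
have g2 : gaussR (k + d) != 0 :> R by rewrite gt_eqF ?gaussR_gt0.
move: p0; set p := peak => p0.
by rewrite exprS; field; rewrite p0 g1 g2 expf_neq0.
Qed.

End SphereMoments.

(** * Polynomial moments of [u = eta . x] *)

Section SpherePolynomials.
Context {R : realType} (d : nat) (eta : sphere R d).
Local Notation leb := (@lebesgue_measure R).
Local Notation U := (@unif_sphere R d).
Local Notation peak := ((Num.sqrt (pi *+ 2))^-1 : R).
Let u (x : sphere R d) : R := dotp (sphere_val eta) (sphere_val x).
(** Half of E |u|^k, the contribution of either sign of u. *)
Let half_moment k : R := peak * gaussR d * gaussR k / gaussR (k + d).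

Let measurable_u : measurable_fun [set: sphere R d] u := measurable_sphere_dotp eta.

(** The signs of u are treated separately because [integral_unif_homogeneous] asks for a nonnegative
    function. *)
Lemma integral_unif_pos k :
  (\int[U]_x ((0 <= u x)%R%:R * u x ^+ k)%:E = (half_moment k)%:E)%E.
Proof.
rewrite (@integral_unif_homogeneous _ _ eta (fun y => (0 <= y)%R%:R * y ^+ k) k).
- have -> : (\int[leb]_x ((0 <= x)%R%:R * x ^+ k * expR (- x ^+ 2 / 2))%:E =
      (gaussR k)%:E)%E.
    under eq_integral do rewrite -mulrA.
    rewrite -(integral_mkbool _ (D := (`[0%R, +oo[%classic : set (measurableTypeR R)))); last first.
      by move=> x; rewrite /= in_itv [X in is_true X <-> _]andbT; exact: iff_refl.
    rewrite -integral_itv_obnd_cbnd -?gauss_int_itv ?gauss_intE//.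
    apply/measurable_funTS/measurable_EFinP; apply: measurable_funM.
      exact: measurable_funX.
    exact: measurable_gauss.
  by rewrite -EFinM /half_moment mulrAC.
- apply: measurable_funM; last exact: measurable_funX.
  by apply: measurable_fun_natr_bool; exact: measurable_fun_ler.
- by move=> y; case: (leP 0 y) => y0; rewrite ?mul0r// mul1r exprn_ge0.
- by move=> c y c0; rewrite pmulr_rge0// exprMn mulrCA.
Qed.

Lemma integral_unif_neg k :
  (\int[U]_x ((u x < 0)%R%:R * (- u x) ^+ k)%:E = (half_moment k)%:E)%E.
Proof.
rewrite (@integral_unif_homogeneous _ _ eta (fun y => (y < 0)%R%:R * (- y) ^+ k) k).
- have -> : (\int[leb]_x ((x < 0)%R%:R * (- x) ^+ k * expR (- x ^+ 2 / 2))%:E =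
      (gaussR k)%:E)%E.
    rewrite integral_oppr.
    + rewrite -gauss_intE; apply: eq_integral => x _.
      by rewrite oppr_lt0 opprK sqrrN mulrA.
    + apply/measurable_EFinP; apply: measurable_funM; last exact: measurable_gauss.
      apply: measurable_funM; last by apply: measurable_funX; exact: measurable_funN.
      by apply: measurable_fun_natr_bool; exact: measurable_fun_ltr.
    + move=> x; rewrite lee_fin; case: (ltP x 0) => x0; rewrite ?mul0r// mul1r.
      by rewrite mulr_ge0 ?expR_ge0// exprn_ge0// oppr_ge0 ltW.
  by rewrite -EFinM /half_moment mulrAC.
- apply: measurable_funM; last by apply: measurable_funX; exact: measurable_funN.
  by apply: measurable_fun_natr_bool; exact: measurable_fun_ltr.
- move=> y; case: (ltP y 0) => y0; rewrite ?mul0r// mul1r exprn_ge0//.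
  by rewrite oppr_ge0 ltW.
- by move=> c y c0; rewrite pmulr_rlt0// -mulrN exprMn mulrCA.
Qed.

Lemma unif_sphereT : U setT = 1%E.
Proof. exact: (@probability_setT _ _ _ (unif_sphere d)). Qed.

Lemma integrable_unif_bounded (f : sphere R d -> R) (M : R) :
  measurable_fun setT f -> (forall x, `|f x| <= M) ->
  U.-integrable setT (EFin \o f).
Proof.
move=> mf fM; apply: measurable_bounded_integrable => //.
- exact: (le_lt_trans (probability_le1 U measurableT) (ltry 1)).
- exists M; split; first exact: num_real.
  by move=> t Mt x _; exact: (le_trans (fM x) (ltW Mt)).
Qed.

Lemma sphere_dotp_norm x : `|u x| <= 1.
Proof. by rewrite ler_norml; exact: sphere_dotp_bound. Qed.

Lemma integrable_horner (p : {poly R}) :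
  U.-integrable setT (fun x => (p.[u x])%:E).
Proof.
have mp : measurable_fun setT (fun x => p.[u x]).
  rewrite (_ : (fun _ => _) = fun x => \sum_(i < size p) p`_i * u x ^+ i).
    apply: measurable_sum => i; apply: measurable_funM => //.
    exact: measurable_funX.
  by apply/funext => x; rewrite horner_coef.
apply: (@integrable_unif_bounded _ (\sum_(i < size p) `|p`_i|) mp) => x.
rewrite horner_coef (le_trans (ler_norm_sum _ _ _))//; apply: ler_sum => i _.
rewrite normrM ler_piMr// normrX exprn_ile1//; exact: sphere_dotp_norm.
Qed.

(** As a linear functional on polynomials it reduces identities between moments to ring
    computations. *)
Definition sphere_moment (p : {poly R}) : R := \int[U]_x p.[u x].
Local Notation L := sphere_moment.

Lemma sphere_momentD p q : L (p + q) = L p + L q.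
Proof.
rewrite /L -RintegralD//; [|exact: integrable_horner..].
by apply: eq_Rintegral => x _; rewrite hornerD.
Qed.

Lemma sphere_momentZ c p : L (c *: p) = c * L p.
Proof.
rewrite /L -RintegralZl//; last exact: integrable_horner.
by apply: eq_Rintegral => x _; rewrite hornerZ.
Qed.

Lemma sphere_momentB p q : L (p - q) = L p - L q.
Proof. by rewrite sphere_momentD -scaleN1r sphere_momentZ mulN1r. Qed.

Lemma sphere_moment1 : L 1 = 1.
Proof.
rewrite /L (_ : (fun _ => _) = cst 1); last by apply/funext => x; rewrite hornerC.
by rewrite Rintegral_cst// [fine _](congr1 fine unif_sphereT) mulr1.
Qed.

Lemma sphere_momentX k : L 'X^k = (1 + (-1) ^+ k) * half_moment k.
Proof.
have m1 : measurable_fun setT (fun x => (0 <= u x)%R%:R * u x ^+ k).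
  apply: measurable_funM; last exact: measurable_funX.
  by apply: measurable_fun_natr_bool; exact: measurable_fun_ler.
have m2 : measurable_fun setT (fun x => (u x < 0)%R%:R * (- u x) ^+ k).
  apply: measurable_funM; last by apply: measurable_funX; exact: measurable_funN.
  by apply: measurable_fun_natr_bool; exact: measurable_fun_ltr.
have i1 : U.-integrable setT (fun x => ((0 <= u x)%R%:R * u x ^+ k)%:E).
  apply: (@integrable_unif_bounded _ 1 m1) => x; rewrite normrM mulr_ile1//.
    by rewrite normr_nat lern1 leq_b1.
  by rewrite normrX exprn_ile1// sphere_dotp_norm.
have i2 : U.-integrable setT (fun x => ((u x < 0)%R%:R * (- u x) ^+ k)%:E).
  apply: (@integrable_unif_bounded _ 1 m2) => x; rewrite normrM mulr_ile1//.
    by rewrite normr_nat lern1 leq_b1.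
  by rewrite normrX normrN exprn_ile1// sphere_dotp_norm.
have E1 : \int[U]_x ((0 <= u x)%R%:R * u x ^+ k) = half_moment k.
  by rewrite /Rintegral integral_unif_pos.
have E2 : \int[U]_x ((u x < 0)%R%:R * (- u x) ^+ k) = half_moment k.
  by rewrite /Rintegral integral_unif_neg.
rewrite mulrDl mul1r -{1}E1 -E2 -RintegralZl// -RintegralD//; last first.
  exact: (integrableZl measurableT ((-1) ^+ k) i2).
apply: eq_Rintegral => x _; rewrite hornerXn.
have [u0|u0] := leP 0 (u x); first by rewrite mul0r mulr0 mul1r addr0.
by rewrite mul0r add0r mul1r -exprMn mulN1r opprK.
Qed.

Lemma half_momentSS k : (k + d).+1%:R * half_moment k.+2 = k.+1%:R * half_moment k.
Proof.
rewrite /half_moment !addSn !gaussRSS.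
have g0 : gaussR (k + d) != 0 :> R by rewrite gt_eqF ?gaussR_gt0.
have : (k + d).+1%:R != 0 :> R by rewrite pnatr_eq0.
move: (_.+1%:R) (gaussR (k + d)) (k.+1%:R) (peak) g0 => a b c e b0 a0.
by field; rewrite b0 a0.
Qed.

(* This is integration by parts for the density of [u], which is proportional
   to [(1 - t^2) ^ (d/2 - 1)]; it is derived from the moments instead. *)
Lemma sphere_moment_byparts (p : {poly R}) :
  L ((1 - 'X^2) * p^`()) = d%:R * L ('X * p).
Proof.
pose D (q : {poly R}) := (1 - 'X^2) * q^`() - d%:R *: ('X * q).
suff : L (D p) = 0.
  by rewrite /D sphere_momentB sphere_momentZ => /eqP; rewrite subr_eq0 => /eqP.
(* [D] is linear, so only monomials have to be checked. *)
rewrite -[p]coefK poly_def; apply: (big_ind (fun q => L (D q) = 0)).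
- by rewrite /D deriv0 !mulr0 scaler0 subr0 -(scale0r 1) sphere_momentZ mul0r.
- move=> q r Eq Er; have -> : D (q + r) = D q + D r.
    by rewrite /D derivD !mulrDr scalerDr; ring.
  by rewrite sphere_momentD Eq Er addr0.
move=> i _; have -> : D (p`_i *: 'X^i) = p`_i *: D 'X^i.
  by rewrite /D derivZ -!mul_polyC; ring.
rewrite sphere_momentZ (_ : L (D _) = 0) ?mulr0//.
case: (nat_of_ord i) => [|k].
  rewrite /D expr0 derivC mulr0 sub0r mulr1 -scaleNr sphere_momentZ.
  by rewrite -['X]expr1 sphere_momentX expr1 subrr mul0r mulr0.
(* The two monomials have the same parity, and their moments are tied by [half_momentSS]. *)
have -> : D 'X^(k.+1) = k.+1%:R *: 'X^k - (k + d).+1%:R *: 'X^(k.+2).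
  rewrite /D derivXn /= -mulr_natl -scaler_nat -!mul_polyC.
  rewrite -[(k + d).+1]addSn natrD polyCD !exprS.
  by rewrite !polyCMn; ring.
rewrite sphere_momentB !sphere_momentZ !sphere_momentX mulrCA (mulrCA (k + d).+1%:R).
by rewrite half_momentSS exprS exprS mulN1r mulN1r opprK subrr.
Qed.

(** For d >= 1, up to normalization and a power of 2, the Beta function at (j + d/2, n + d/2). *)
Definition sphere_beta j n : R := L ((1 - 'X) ^+ j * (1 + 'X) ^+ n).
Local Notation B := sphere_beta.

Lemma sphere_betaD j n : B j.+1 n + B j n.+1 = 2 * B j n.
Proof.
rewrite /B -sphere_momentD -sphere_momentZ; congr (L _).
by rewrite -mul_polyC !exprS polyCMn; ring.
Qed.

(** For p = (1 - X)^j (1 + X)^n one has (1 - X^2) p' = n (1 - X) p - j (1 + X) p, while 2 X = (1 +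
    X) - (1 - X). *)
Lemma sphere_beta_byparts j n :
  (2 * n%:R + d%:R) * B j.+1 n = (2 * j%:R + d%:R) * B j n.+1.
Proof.
pose p : {poly R} := (1 - 'X) ^+ j * (1 + 'X) ^+ n.
have Dp : (1 - 'X^2) * p^`() = n%:R *: ((1 - 'X) * p) - j%:R *: ((1 + 'X) * p).
  have D1 m : (1 - 'X) * ((1 - 'X) ^+ m)^`() = - (m%:R *: (1 - 'X) ^+ m) :> {poly R}.
    rewrite deriv_exp derivB derivC derivX sub0r; case: m => [|m].
      by rewrite mulr0n mulr0 scale0r oppr0.
    by rewrite scaler_nat exprS mulN1r mulNrn mulrN mulrnAr.
  have D2 m : (1 + 'X) * ((1 + 'X) ^+ m)^`() = m%:R *: (1 + 'X) ^+ m :> {poly R}.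
    rewrite deriv_exp derivD derivC derivX add0r; case: m => [|m].
      by rewrite mulr0n mulr0 scale0r.
    by rewrite scaler_nat exprS mul1r mulrnAr.
  transitivity ((1 + 'X) * ((1 + 'X) ^+ n) * ((1 - 'X) * ((1 - 'X) ^+ j)^`()) +
      (1 - 'X) * ((1 - 'X) ^+ j) * ((1 + 'X) * ((1 + 'X) ^+ n)^`()) : {poly R}).
    by rewrite /p derivM; ring.
  rewrite D1 D2 /p -!mul_polyC; ring.
have := sphere_moment_byparts p.
rewrite Dp sphere_momentB !sphere_momentZ.
have -> : (1 - 'X) * p = (1 - 'X) ^+ j.+1 * (1 + 'X) ^+ n by rewrite exprS mulrA.
have -> : (1 + 'X) * p = (1 - 'X) ^+ j * (1 + 'X) ^+ n.+1 by rewrite exprS mulrCA.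
have -> : 'X * p = 2^-1 *: ((1 - 'X) ^+ j * (1 + 'X) ^+ n.+1) -
                   2^-1 *: ((1 - 'X) ^+ j.+1 * (1 + 'X) ^+ n).
  rewrite -scalerBr -[LHS]scale1r -[in LHS](mulVf (_ : 2 != 0 :> R))// -scalerA; congr (_ *: _).
  by rewrite -mul_polyC polyCMn !exprS /p; ring.
rewrite sphere_momentB !sphere_momentZ -!/(B _ _) => E.
by apply/eqP; rewrite -subr_eq0; move/eqP: E; rewrite -subr_eq0 => /eqP E;
  apply/eqP; lra.
Qed.

(** B(j+1, n) is eliminated between integration by parts and the identity (1 - u) + (1 + u) = 2. *)
Lemma sphere_beta_rec j n : (n + j + d)%:R * B j n.+1 = (2 * n + d)%:R * B j n.
Proof.
have := sphere_betaD j n; have := sphere_beta_byparts j n.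
have -> : (2 * n + d)%:R = 2 * n%:R + d%:R :> R by rewrite natrD natrM.
rewrite !natrD => E1 E2.
have E3 : B j.+1 n = 2 * B j n - B j n.+1 by rewrite -E2 addrK.
by move: E1; rewrite E3 => E1; lra.
Qed.

Lemma sphere_beta_gt0 j n : (0 < d)%N -> 0 < B j n.
Proof.
move=> d0; elim: n => [|n IHn].
  elim: j => [|j IHj]; first by rewrite /B !expr0 mul1r sphere_moment1.
  have E1 := sphere_betaD j 0; have E2 := sphere_beta_rec j 0.
  have jd : 0 < (0 + j + d)%:R :> R by rewrite ltr0n addn_gt0 d0 orbT.
  rewrite -(pmulr_rgt0 _ jd).
  (* The mirror recursion in j, on the row n = 0; from there the recursion in n propagates
     positivity. *)
  have -> : (0 + j + d)%:R * B j.+1 0 = (2 * j%:R + d%:R) * B j 0.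
    have -> : B j.+1 0 = 2 * B j 0 - B j 1 by rewrite -E1 addrK.
    by rewrite mulrBr E2 !natrD /=; ring.
  by rewrite mulr_gt0// ltr_wpDl ?ltr0n// mulr_ge0.
have jd : 0 < (n + j + d)%:R :> R by rewrite ltr0n addn_gt0 d0 orbT.
by rewrite -(pmulr_rgt0 _ jd) sphere_beta_rec mulr_gt0// ltr0n addn_gt0 d0 orbT.
Qed.

End SpherePolynomials.

(** * Normalizing constants *)

Section Constants.
Context {R : realType}.
Local Notation leb := (@lebesgue_measure R).

(** Indexing by twice the argument puts integers and half-integers on the same footing. *)
Definition Gamma_half (k : nat) : R := Gamma (k%:R / 2).
Local Notation Gh := Gamma_half.

Lemma Gamma_halfE (x : R) k : x = k%:R / 2 -> Gamma x = Gh k.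
Proof. by move=> ->. Qed.

Lemma Gamma_half_gt0 k : 0 < Gh k.+1.
Proof. by rewrite /Gh Gamma_half_int mulr_gt0 ?gaussR_gt0 ?powR_gt0. Qed.

Lemma Gamma_half_neq0 k : Gh k.+1 != 0.
Proof. by rewrite gt_eqF ?Gamma_half_gt0. Qed.

Lemma Gamma_halfSS k : Gh k.+3 = k.+1%:R / 2 * Gh k.+1.
Proof.
rewrite /Gh !Gamma_half_int gaussRSS.
rewrite (_ : (1 - k.+2%:R) / 2 = (1 - k%:R) / 2 - 1 :> R); last first.
  by rewrite -addn2 natrD; field.
rewrite powRD; last by rewrite pnatr_eq0 implybT.
by rewrite powR_inv1//; ring.
Qed.

Lemma Gamma_half_double d : Gh d.+2.*2 = d.+1%:R * Gh d.+1.*2.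
Proof.
have -> : d.+2.*2 = (d.*2.+1).+3 by rewrite !doubleS.
rewrite Gamma_halfSS; congr (_ * _).
by rewrite -[d.*2.+2]/(d.+1.*2) -mul2n natrM mulrC mulKf.
Qed.

(** Legendre's duplication formula at (d+1)/2. It is trivial at d = 0, and the functional equation
    carries it upwards. *)
Lemma Gamma_half_duplication d :
  Gh 1 * Gh d.+1.*2 = 2 ^+ d * Gh d.+1 * Gh d.+2.
Proof.
elim: d => [|d IHd]; first by rewrite expr0 mul1r.
rewrite Gamma_half_double mulrCA IHd [Gh d.+3]Gamma_halfSS exprS.
by field.
Qed.

(** The dimension is d+1, so lambda = d/2. With p = 1 the factor Gamma (lambda + 1/2) cancels
    against Gamma (p + lambda - 1/2). *)
Lemma sbeta_constE d n : sbeta_const d.+1 1 (n%:R + 1) =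
  (2 ^+ (n + d))^-1 * (Gh 1 * Gh (n + d).+1.*2) / (Gh d.+2 * Gh (n.*2 + d).+1) :> R.
Proof.
rewrite /sbeta_const /lambda_of.
have -> : - (1 + (n%:R + 1) + 2 * ((d.+1%:R - 1) / 2 - 1)) = - (n + d)%:R :> R.
  by rewrite natrD -natr1; field.
have -> : Gamma ((d.+1%:R - 1) / 2 + 2^-1) = Gh d.+1.
  by apply: Gamma_halfE; rewrite -natr1; field.
have -> : Gamma (1 + (n%:R + 1) + 2 * ((d.+1%:R - 1) / 2) - 1) = Gh (n + d).+1.*2.
  by apply: Gamma_halfE; rewrite -muln2 natrM -!natr1 natrD; field.
have -> : Gamma ((d.+1%:R - 1) / 2 + 1) = Gh d.+2.
  by apply: Gamma_halfE; rewrite -!natr1; field.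
have -> : Gamma (1 + (d.+1%:R - 1) / 2 - 2^-1) = Gh d.+1.
  by apply: Gamma_halfE; rewrite -natr1; field.
have -> : Gamma (n%:R + 1 + (d.+1%:R - 1) / 2 - 2^-1) = Gh (n.*2 + d).+1.
  by apply: Gamma_halfE; rewrite -!natr1 natrD -muln2 natrM; field.
have -> : Gamma 2^-1 = Gh 1 by apply: Gamma_halfE; rewrite mul1r.
rewrite powR_invn//.
have h1 := Gamma_half_neq0 d; have h2 := Gamma_half_neq0 d.+1.
have h3 := Gamma_half_neq0 (n.*2 + d).
move: (Gh d.+1) (Gh d.+2) (Gh (n.*2 + d).+1) h1 h2 h3 => a b c h1 h2 h3.
by field; rewrite h1 h2 h3 expf_neq0.
Qed.

Lemma sbeta_const_gt0 d n : (0 < d)%N -> 0 < sbeta_const d 1 (n%:R + 1) :> R.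
Proof.
case: d => // d _; rewrite sbeta_constE divr_gt0 ?mulr_gt0 ?invr_gt0 ?exprn_gt0//;
  by rewrite ?doubleS Gamma_half_gt0.
Qed.

(** The n-th density has total mass 1. At n = 0 this is the duplication formula; the step compares
    the functional equation of Gamma with [sphere_beta_rec]. *)
Lemma sbeta_const_beta d (eta : sphere R d) n : (0 < d)%N ->
  sbeta_const d 1 (n%:R + 1) * sphere_beta eta 0 n = 1.
Proof.
case: d eta => // d eta _; rewrite sbeta_constE.
have h2 := Gamma_half_neq0 d.+1.
elim: n => [|n IHn].
  rewrite /sphere_beta !expr0 mulr1 sphere_moment1 mulr1 !add0n Gamma_half_duplication.
  have h1 := Gamma_half_neq0 d.
  move: (Gh d.+1) (Gh d.+2) h1 h2 => a b h1 h2.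
  by field; rewrite h1 h2 expf_neq0.
rewrite -[RHS]IHn.
have := sphere_beta_rec eta 0 n; rewrite addn0 => E.
have nd : (n + d.+1)%:R != 0 :> R by rewrite pnatr_eq0 addnS.
have -> : sphere_beta eta 0 n.+1 = (2 * n + d.+1)%:R / (n + d.+1)%:R * sphere_beta eta 0 n.
  by apply: (mulfI nd); rewrite E; field.
rewrite doubleS addSn !doubleS Gamma_halfSS -doubleS addSn Gamma_halfSS exprS.
have h3 := Gamma_half_neq0 (n.*2 + d).
have -> : (n + d).*2.+2%:R = 2 * (n + d.+1)%:R :> R.
  by rewrite -doubleS -addnS -mul2n natrM.
have e1 : (n.*2 + d).+1%:R = (2 * n + d.+1)%:R :> R by rewrite addnS mul2n.
have nd2 : (2 * n + d.+1)%:R != 0 :> R by rewrite pnatr_eq0 addnS.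
rewrite e1.
move: (Gh d.+2) (Gh (n.*2 + d).+1) h2 h3 => a b h2 h3.
move: ((n + d.+1)%:R) ((2 * n + d.+1)%:R) nd nd2 => x y nd nd2.
by field; rewrite nd nd2 h2 h3 expf_neq0.
Qed.

(** Equals Gamma (k+d+1) exp (s^2/4) D_{-(k+d+1)}(s), the index being k + 2 delta for delta = lambda
    + 1. *)
Definition pc_int (d k : nat) (s : R) : R :=
  \int[leb]_(r in `]0%R, +oo[) (r ^+ (k + d) * expR (- (s * r) - r ^+ 2 / 2)).

(** The coefficient of (1 + u)^k in the density of the angular Gaussian law, which is what fixes the
    form of [dpc]. *)
Lemma dpc_sbeta_const d (rho : R) k : (0 < d)%N ->
  dpc (lambda_of d + 1) rho k * sbeta_const d 1 (k%:R + 1) =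
  k`!%:R^-1 * (Num.sqrt 2 * rho) ^+ k * expR (- rho ^+ 2) *
    (pc_int d k (Num.sqrt 2 * rho) / gaussR d).
Proof.
case: d => // d _; rewrite sbeta_constE /dpc /parabolic_cylinder /lambda_of.
have -> : k%:R + ((d.+1%:R - 1) / 2 + 1) - 1 = (k + d)%:R + (1 - d.+1%:R) / 2 :> R.
  by rewrite -natr1 natrD; field.
have -> : k%:R + 2 * ((d.+1%:R - 1) / 2 + 1) - 1 = (k + d).+1%:R :> R.
  by rewrite -!natr1 natrD; field.
have -> : Gamma (k%:R + ((d.+1%:R - 1) / 2 + 1) - 2^-1) = Gh (k.*2 + d).+1.
  by apply: Gamma_halfE; rewrite -!natr1 natrD -muln2 natrM; field.
rewrite !opprK.
have -> : Gamma (k%:R + 2 * ((d.+1%:R - 1) / 2 + 1)) = Gh (k + d).+2.*2.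
  by apply: Gamma_halfE; rewrite -muln2 natrM -!natr1 natrD; field.
have -> : Gamma 2^-1 = Gh 1 by apply: Gamma_halfE; rewrite mul1r.
set J := Rintegral _ _ _.
have -> : J = pc_int d.+1 k (Num.sqrt 2 * rho).
  apply: eq_Rintegral => r; rewrite inE/= in_itv/= andbT => r0.
  rewrite (_ : _ - 1 = (k + d.+1)%:R) ?powR_mulrn ?ltW//.
  by rewrite natrD -!natr1; field.
rewrite Gamma_half_double.
have gE : Gh d.+2 = 2 `^ ((1 - d.+1%:R) / 2) * gaussR d.+1.
  by rewrite /Gh Gamma_half_int.
rewrite powRD; last by rewrite pnatr_eq0 implybT.
(* One half of the exponent stands explicitly in [dpc], the other is exp (- z^2/4) in D at z = sqrt
   2 rho. *)
rewrite powR_mulrn// gE (_ : expR (- rho ^+ 2) =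
  expR (- (rho ^+ 2 / 2)) * expR (- ((Num.sqrt 2 * rho) ^+ 2 / 4))); last first.
  by rewrite -expRD exprMn sqr_sqrtr//; congr expR; field.
have h1 := Gamma_half_neq0 0; have h2 := Gamma_half_neq0 (k.*2 + d).
have h3 : Gh (k + d).+1.*2 != 0 by rewrite doubleS Gamma_half_neq0.
have h4 : (k + d).+1%:R != 0 :> R by rewrite pnatr_eq0.
have h5 : gaussR d.+1 != 0 :> R by rewrite gt_eqF ?gaussR_gt0.
have h6 : 2 `^ ((1 - d.+1%:R) / 2) != 0 :> R by rewrite gt_eqF ?powR_gt0.
have h7 : k`!%:R != 0 :> R by rewrite pnatr_eq0 -lt0n fact_gt0.
have h8 : 2 ^+ (k + d) != 0 :> R by rewrite expf_neq0.
move: (Gh 1) (Gh _.*2) ((k + d).+1%:R) (gaussR _) (_ `^ _) (k`!%:R) h1 h3 h4 h5 h6 h7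
  => a b c e f g h1 h3 h4 h5 h6 h7.
move: (pc_int _ _ _) (expR _) (expR _) ((Num.sqrt 2 * rho) ^+ k) => x y z t.
by field; rewrite h1 h2 h3 h4 h5 h6 h7 h8.
Qed.

End Constants.

(** * Uniqueness of the weights *)

(* [q j n] stands for the integral of [(1 - u) ^ j] against the n-th component.
   As [j] grows, the components with index larger than [n] become negligible
   compared to the n-th one. *)
Section MixtureUniqueness.
Context {R : realType}.
Variables (d : nat) (q : nat -> nat -> R).
Hypotheses (d0 : (0 < d)%N) (q0 : forall j n, 0 < q j n).
Hypothesis qS : forall j n, (n + j + d)%:R * q j n.+1 = (n + d)%:R * q j n.

Let eps j n : R := (n + d)%:R / (n + j + d)%:R.

Let den_gt0 j n : 0 < (n + j + d)%:R :> R.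
Proof. by rewrite ltr0n addn_gt0 d0 orbT. Qed.

Let qSE j n : q j n.+1 = eps j n * q j n.
Proof.
have j0 := lt0r_neq0 (den_gt0 j n).
apply: (mulfI j0); rewrite qS /eps.
by move: (n + j + d)%:R j0 => a a0; field.
Qed.

Let q_nincr j n : q j n.+1 <= q j n.
Proof.
rewrite qSE; apply: ler_piMl; first exact: ltW.
by rewrite /eps ler_pdivrMr ?den_gt0// mul1r ler_nat leq_add2r leq_addr.
Qed.

Let q_tail j n k : (n < k)%N -> q j k <= eps j n * q j n.
Proof.
elim: k => // k IHk; rewrite ltnS leq_eqVlt => /predU1P[->|nk]; first by rewrite qSE.
exact: le_trans (q_nincr _ _) (IHk nk).
Qed.

Let eps_small (n : nat) (e : R) : 0 < e -> exists j, eps j n < e.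
Proof.
move=> e0; have nd0 : 0 <= (n + d)%:R / e by rewrite divr_ge0// ltW.
exists (Num.bound ((n + d)%:R / e)).
rewrite /eps ltr_pdivrMr ?den_gt0// mulrC -ltr_pdivrMr//.
apply: lt_le_trans (archi_boundP nd0) _; rewrite ler_nat.
by rewrite addnAC leq_addl.
Qed.

(** Once the equal terms below n are cancelled, the tail of [w] is at least its n-th term, and that
    of [v] exceeds its own n-th term by at most [eps j n * q j n]. Letting j grow gives one
    inequality, and exchanging the roles gives the other. *)
Lemma mixture_weights_le (w v : nat -> R) : (forall n, 0 <= w n) -> is_pmf v ->
  (forall j, \sum_(0 <= n <oo) (w n * q j n)%:E = \sum_(0 <= n <oo) (v n * q j n)%:E)%E ->
  forall n, (forall k, (k < n)%N -> w k = v k) -> w n <= v n.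
Proof.
move=> w0 [v0 v1] E n wv.
have wq0 j k : (0 <= (w k * q j k)%:E)%E by rewrite lee_fin mulr_ge0// ltW.
have vq0 j k : (0 <= (v k * q j k)%:E)%E by rewrite lee_fin mulr_ge0// ltW.
have tail j : (\sum_(n <= k <oo) (w k * q j k)%:E = \sum_(n <= k <oo) (v k * q j k)%:E)%E.
  have := E j.
  rewrite (nneseries_split 0 n); last by move=> k _; exact: wq0.
  rewrite [RHS](nneseries_split 0 n); last by move=> k _; exact: vq0.
  rewrite !add0n (_ : \sum_(0 <= k < n) (w k * q j k)%:E = \sum_(0 <= k < n) (v k * q j k)%:E)%E.
    rewrite sumEFin => /(congr1 (fun x => x - (\sum_(0 <= i < n) v i * q j i)%:E)%E).
    by rewrite ![((\sum_(_ <= _ < _) _)%:E + _)%E]addeC !addeK.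
  by apply: eq_big_nat => k /andP[_ kn]; rewrite wv.
have wvj j : w n <= v n + eps j n.
  rewrite -(ler_pM2r (q0 j n)) -lee_fin.
  apply: (@le_trans _ _ (\sum_(n <= k <oo) (w k * q j k)%:E)%E).
    rewrite (nneseries_split n 1); last by move=> k _; exact: wq0.
    rewrite addn1 big_nat1; apply: leeDl.
    by apply: nneseries_ge0 => k _ _; exact: wq0.
  rewrite tail (nneseries_split n 1); last by move=> k _; exact: vq0.
  rewrite addn1 big_nat1 mulrDl EFinD; apply: leeD => //.
  (* Beyond n each [q j k] is at most [eps j n * q j n], and the remaining weights of [v] sum to at
     most 1. *)
  rewrite -(nneseries_addn n.+1 (vq0 j)).
  apply: (@le_trans _ _ (\sum_(0 <= k <oo) ((eps j n * q j n)%:E * (v (k + n.+1)%N)%:E))%E).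
    apply: lee_nneseries => k _; first by move=> _; exact: vq0.
    rewrite -EFinM lee_fin mulrC ler_wpM2r//; apply: q_tail.
    by rewrite addnS ltnS leq_addl.
  rewrite nneseriesZl; last by move=> k _; rewrite lee_fin.
  rewrite (nneseries_addn n.+1 (f := fun k => (v k)%:E)); last first.
    by move=> k; rewrite lee_fin.
  rewrite -[leRHS]mule1 lee_wpmul2l//; first by rewrite lee_fin mulr_ge0 ?divr_ge0// ltW.
  rewrite -v1 [leRHS](nneseries_split 0 n.+1); last by move=> k _; rewrite lee_fin.
  by rewrite add0n leeDr// sume_ge0// => k _; rewrite lee_fin.
rewrite leNgt; apply/negP => vw.
have wv0 : 0 < w n - v n by rewrite subr_gt0.
have [j] := eps_small n wv0.
by rewrite ltNge lerBlDl wvj.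
Qed.

Lemma mixture_weights_unique (w v : nat -> R) : is_pmf w -> is_pmf v ->
  (forall j, \sum_(0 <= n <oo) (w n * q j n)%:E = \sum_(0 <= n <oo) (v n * q j n)%:E)%E ->
  w = v.
Proof.
move=> pw pv E; apply/funext => n; elim/ltn_ind: n => n IHn.
apply/eqP; rewrite eq_le; apply/andP; split.
- by apply: mixture_weights_le => //; case: pw.
- apply: mixture_weights_le => //; first by case: pv.
  by move=> k kn; rewrite IHn.
Qed.

End MixtureUniqueness.

(** * The mixture representation *)

Section MixtureMeasure.
Context {disp : measure_display} {T : measurableType disp} {R : realType}.

Lemma is_probability_density (mu : {measure set T -> \bar R}) (g : T -> R) :
  measurable_fun setT g -> (forall x, 0 <= g x) ->
  (\int[mu]_x (g x)%:E = 1)%E ->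
  is_probability (fun A => (\int[mu]_(x in A) (g x)%:E)%E).
Proof.
move=> mg g0 g1; pose nu (A : set T) := (\int[mu]_(x in A) (g x)%:E)%E.
have nu0 : nu set0 = 0%E by rewrite /nu integral_set0.
have nu_ge0 A : (0 <= nu A)%E by apply: integral_ge0 => x _; rewrite lee_fin.
have nus : semi_sigma_additive nu.
  apply: semi_sigma_additive_nng_induced; first exact/measurable_EFinP.
  by move=> x; rewrite lee_fin.
pose m : {measure set T -> \bar R} :=
  HB.pack nu (isMeasure.Build _ _ _ nu nu0 nu_ge0 nus).
pose P : probability T R := HB.pack nu (Measure.on m)
  (Measure_isProbability.Build _ _ _ m g1).
by exists P.
Qed.

(** The mixture identity on sets says that [P] agrees with a series of scaled measures, along which
    integrals split. *)
Lemma ge0_integral_mixture (P : probability T R) (Q : nat -> set T -> \bar R)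
    (w : nat -> R) (mu : {measure set T -> \bar R}) (g : nat -> T -> R) (f : T -> \bar R) :
  (forall n, is_probability (Q n)) -> (forall n, 0 <= w n) ->
  (forall A, measurable A -> P A = \sum_(0 <= n <oo) (w n)%:E * Q n A)%E ->
  (forall n, measurable_fun setT (g n)) -> (forall n x, 0 <= g n x) ->
  (forall n A, measurable A -> Q n A = \int[mu]_(x in A) (g n x)%:E)%E ->
  measurable_fun setT f -> (forall x, 0 <= f x)%E ->
  (\int[P]_x f x = \sum_(0 <= n <oo) (w n)%:E * \int[mu]_x (f x * (g n x)%:E))%E.
Proof.
move=> /choice[p pQ] w0 PE mg g0 QE mf f0.
pose m n := mscale (NngNum (w0 n)) (p n).
rewrite (@eq_measure_integral _ _ _ _ (mseries m 0)); last first.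
  move=> A mA _; rewrite [LHS](PE A mA); apply: eq_eseriesr => n _.
  by rewrite /m /= /mscale/= pQ.
rewrite ge0_integral_measure_series//; apply: eq_eseriesr => n _.
rewrite ge0_integral_mscale//; congr (_ * _)%E.
apply: ge0_integral_density => // A mA.
by move: (pQ n A mA); rewrite QE// => <-.
Qed.

End MixtureMeasure.

Lemma expR_nneseries (R : realType) (x : R) : 0 <= x ->
  ((expR x)%:E = \sum_(0 <= k <oo) (x ^+ k / k`!%:R)%:E)%E.
Proof.
move=> x0; rewrite /expR -EFin_lim; last exact: is_cvg_series_exp_coeff.
congr (limn _); apply/funext => n /=.
by rewrite /series/= -sumEFin.
Qed.

(** * The angular Gaussian law: expansion and determination of its weights *)

Section AngularGaussian.
Context {R : realType} (d : nat) (eta : sphere R d).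
Hypothesis d0 : (0 < d)%N.
Local Notation mu := (@lebesgue_tuple R d.+1).
Local Notation leb := (@lebesgue_measure R).
Local Notation U := (@unif_sphere R d).
Local Notation peak := ((Num.sqrt (pi *+ 2))^-1 : R).
Let u (x : sphere R d) : R := dotp (sphere_val eta) (sphere_val x).
Let c n : R := sbeta_const d 1 (n%:R + 1).

Let measurable_u : measurable_fun [set: sphere R d] u := measurable_sphere_dotp eta.

Let c0 n : 0 < c n. Proof. exact: sbeta_const_gt0. Qed.

Let u1_ge0 x : 0 <= 1 + u x.
Proof. by have /andP[+ _] := sphere_dotp_bound eta x; rewrite -/(u x); lra. Qed.

Let u2_ge0 x : 0 <= 1 - u x.
Proof. by have /andP[_] := sphere_dotp_bound eta x; rewrite -/(u x); lra. Qed.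

Let measurable_1Du : measurable_fun setT (fun x => 1 + u x).
Proof. exact: measurable_funD. Qed.

Let measurable_1Bu : measurable_fun setT (fun x => 1 - u x).
Proof. exact: measurable_funB. Qed.

Let g n (x : sphere R d) : R := c n * (1 + u x) ^+ n.

Let mg n : measurable_fun setT (g n).
Proof. by apply: measurable_funM => //; exact: measurable_funX. Qed.

Let g0 n x : 0 <= g n x.
Proof. by rewrite mulr_ge0 ?exprn_ge0// ltW. Qed.

(** Valid at the poles too: a real power with exponent 0 is 1 even at base 0, and 1 + u >= 0 lets
    the other power become a natural one. *)
Lemma sbeta_densityE n x : sbeta_density eta 1 (n%:R + 1) x = g n x.
Proof.
rewrite /sbeta_density subrr powRr0 mulr1 addrK powR_mulrn//.
exact: u1_ge0.
Qed.

Let sbetaE n A : sbeta eta 1 (n%:R + 1) A = (\int[U]_(x in A) (g n x)%:E)%E.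
Proof. by apply: eq_integral => x _; rewrite sbeta_densityE. Qed.

Lemma integral_sphere_beta j n :
  (\int[U]_x ((1 - u x) ^+ j * (1 + u x) ^+ n)%:E = (sphere_beta eta j n)%:E)%E.
Proof.
rewrite /sphere_beta /sphere_moment /Rintegral fineK; last first.
  by apply: integrable_fin_num => //; exact: integrable_horner.
by apply: eq_integral => x _; rewrite !hornerE.
Qed.

Lemma is_probability_sbeta n : is_probability (sbeta eta 1 (n%:R + 1)).
Proof.
have -> : sbeta eta 1 (n%:R + 1) = fun A => (\int[U]_(x in A) (g n x)%:E)%E.
  by apply/funext => A; exact: sbetaE.
apply: is_probability_density => //.
under eq_integral do rewrite /g EFinM.
rewrite ge0_integralZl; last 4 first.
- exact: measurableT.
- by apply/measurable_EFinP; exact: measurable_funX.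
- by move=> x _; rewrite lee_fin exprn_ge0.
- by rewrite lee_fin ltW.
rewrite (_ : (\int[U]_x ((1 + u x) ^+ n)%:E = (sphere_beta eta 0 n)%:E)%E).
  by rewrite -EFinM sbeta_const_beta.
by rewrite -integral_sphere_beta; apply: eq_integral => x _; rewrite expr0 mul1r.
Qed.

Let pc_fun k (s r : R) : R :=
  (0 < r)%R%:R * (r ^+ (k + d) * expR (- (s * r) - r ^+ 2 / 2)).

Let pc_fun_ge0 k s r : 0 <= pc_fun k s r.
Proof.
rewrite /pc_fun; case: (ltP 0 r) => r0; rewrite ?mul0r//.
by rewrite mul1r mulr_ge0 ?expR_ge0// exprn_ge0// ltW.
Qed.

Let measurable_expR_pc (s : R) : measurable_fun [set: measurableTypeR R]
  (fun r : R => expR (- (s * r) - r ^+ 2 / 2)).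
Proof.
apply: measurableT_comp => //; apply: measurable_funB.
  by apply: measurableT_comp => //; exact: measurable_funM.
by apply: measurable_funM => //; exact: measurable_funX.
Qed.

Let measurable_pc_fun k s : measurable_fun [set: measurableTypeR R] (pc_fun k s).
Proof.
apply: measurable_funM.
  by apply: measurable_fun_natr_bool; exact: measurable_fun_ltr.
by apply: measurable_funM => //; exact: measurable_funX.
Qed.

(** [pc_int] is a real-valued integral, so finiteness has to be shown; for s >= 0 the integrand is
    dominated by that of [gauss_int (k + d)]. *)
Let pc_integral k (s : R) : 0 <= s ->
  (\int[leb]_r (pc_fun k s r)%:E = (pc_int d k s)%:E)%E.
Proof.
move=> s0; rewrite /pc_int /Rintegral.
rewrite (integral_mkbool _ (b := fun r : measurableTypeR R => (0 : R) < r)); last first.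
  by move=> r; rewrite /= in_itv [X in is_true X <-> _]andbT; exact: iff_refl.
rewrite fineK// ge0_fin_numE; last first.
  by apply: integral_ge0 => r _; rewrite lee_fin; exact: pc_fun_ge0.
apply: (@le_lt_trans _ _ (gauss_int (k + d))); last first.
  by rewrite gauss_intE ltry.
apply: ge0_le_integral.
- by [].
- by move=> r _; rewrite lee_fin; exact: pc_fun_ge0.
- by apply/measurable_EFinP; exact: measurable_pc_fun.
- by apply/measurable_EFinP; exact: measurable_gauss_int.
- move=> r _; rewrite lee_fin; case: (ltP 0 r) => r0; rewrite ?mul0r//.
  rewrite !mul1r; apply: ler_wpM2l; first by rewrite exprn_ge0// ltW.
  rewrite ler_expR.
  by rewrite mulNr gerDr oppr_le0 mulr_ge0// ltW.
Qed.

(* The exponential series is applied to [s |z| (1 + u) >= 0], rather than to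
   [s |z| u], so that all terms are nonnegative and can be integrated one by one. *)
Lemma prod_normal_pdf_series (s : R) (z : rvec R d.+1) : 0 <= s ->
  ((\prod_(i < d.+1) normal_pdf (tnth (scalet s (sphere_val eta)) i) 1 (tnth z i))%:E =
   \sum_(0 <= k <oo)
     (peak ^+ d.+1 * expR (- (s ^+ 2 / 2)) * (s ^+ k / k`!%:R) *
      ((1 + u (normalize z)) ^+ k *
       (enorm z ^+ k * expR (- (s * enorm z) - enorm z ^+ 2 / 2))))%:E)%E.
Proof.
move=> s0.
have -> : \prod_(i < d.+1) normal_pdf (tnth (scalet s (sphere_val eta)) i) 1 (tnth z i) =
  peak ^+ d.+1 * expR (- (s ^+ 2 / 2)) * expR (- (s * enorm z) - enorm z ^+ 2 / 2) *
  expR (s * enorm z * (1 + u (normalize z))).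
  under eq_bigr do rewrite normal_pdf1E.
  rewrite big_split/= prodr_const card_ord -expR_sum.
  rewrite -[RHS]mulrA -[RHS]mulrA -!expRD; congr (_ * expR _).
  have S1 : dotp (sphere_val eta) (sphere_val eta) = 1.
    by rewrite -enorm_sqr enorm_sphere expr1n.
  (* Expansion of - |z - s eta|^2 / 2; keeping |eta|^2 explicit allows a coordinatewise check. *)
  transitivity (- (s ^+ 2 / 2) * dotp (sphere_val eta) (sphere_val eta) +
      (s * dotp (sphere_val eta) z - 2^-1 * dotp z z)).
    rewrite /dotp !mulr_sumr -sumrN -!big_split/=; apply: eq_bigr => i _.
    by rewrite tnth_mktuple; field.
  rewrite S1 [dotp _ z]dotp_normalize -/(u _) -enorm_sqr.
  by move: (u _) (enorm z) => a b; field.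
rewrite EFinM expR_nneseries; last by rewrite !mulr_ge0 ?enorm_ge0.
rewrite -nneseriesZl; last first.
  by move=> k _; rewrite lee_fin divr_ge0// exprn_ge0// !mulr_ge0 ?enorm_ge0.
apply: eq_eseriesr => k _; rewrite -EFinM; congr EFin.
by rewrite !exprMn; ring.
Qed.

Lemma angular_gaussian_series (rho : R) A : 0 < rho -> measurable A ->
  (angular_gaussian eta rho A = \sum_(0 <= k <oo)
     (dpc (lambda_of d + 1) rho k)%:E * sbeta eta 1 (k%:R + 1) A)%E.
Proof.
move=> rho0 mA; pose s := Num.sqrt 2 * rho.
have s0 : 0 <= s by rewrite mulr_ge0 ?sqrtr_ge0// ltW.
have s2 : s ^+ 2 / 2 = rho ^+ 2 by rewrite exprMn sqr_sqrtr//; field.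
(* Angular part [f] and radial part [h] of the k-th term, in the shape required by
   [polar_integral_unif]. *)
pose f k (x : sphere R d) : R := \1_A x * (1 + u x) ^+ k.
pose h k (r : R) : R := (0 <= r)%R%:R * (peak ^+ d.+1 * expR (- (s ^+ 2 / 2)) *
  (s ^+ k / k`!%:R) * (r ^+ k * expR (- (s * r) - r ^+ 2 / 2))).
have mf k : measurable_fun setT (f k).
  by apply: measurable_funM; [exact: measurable_indic|exact: measurable_funX].
have f0 k x : 0 <= f k x by rewrite mulr_ge0// exprn_ge0.
have mh k : measurable_fun [set: measurableTypeR R] (h k).
  apply: measurable_funM.
    by apply: measurable_fun_natr_bool; exact: measurable_fun_ler.
  by apply: measurable_funM => //; apply: measurable_funM => //; exact: measurable_funX.
have K0 k : 0 <= peak ^+ d.+1 * expR (- (s ^+ 2 / 2)) * (s ^+ k / k`!%:R).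
  by rewrite !mulr_ge0 ?invr_ge0 ?expR_ge0 ?exprn_ge0 ?invr_ge0 ?sqrtr_ge0.
have h0 k r : 0 <= h k r.
  rewrite /h; case: (leP 0 r) => r0; rewrite ?mul0r// mul1r mulr_ge0//.
  by rewrite mulr_ge0 ?expR_ge0// exprn_ge0.
transitivity (\int[mu]_z \sum_(0 <= k <oo) (f k (normalize z) * h k (enorm z))%:E)%E.
  transitivity (\int[gaussian (scalet s (sphere_val eta))]_z (\1_A (normalize z))%:E)%E.
    transitivity (gaussian (scalet s (sphere_val eta)) (@normalize R d @^-1` A)); first by [].
    rewrite -[in LHS](setIT (_ @^-1` A)) -integral_indic//.
    by rewrite -[X in measurable X]setTI; exact: measurable_normalize.
  rewrite ge0_integral_gaussian; last 2 first.
  - apply/measurable_EFinP.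
    apply: (measurableT_comp _ (@measurable_normalize R d)); exact: measurable_indic.
  - by move=> z; rewrite lee_fin.
  apply: eq_integral => z _; rewrite prod_normal_pdf_series//.
  rewrite -nneseriesZl; last first.
    move=> k _; rewrite lee_fin mulr_ge0//.
    by rewrite mulr_ge0 ?exprn_ge0// mulr_ge0 ?expR_ge0// exprn_ge0// enorm_ge0.
  apply: eq_eseriesr => k _; rewrite -EFinM; congr EFin.
  by rewrite /f /h enorm_ge0 mul1r; ring.
rewrite integral_nneseries; last 3 first.
- exact: measurableT.
- move=> k; apply/measurable_EFinP; apply: measurable_funM.
    exact: (measurableT_comp (mf k) (@measurable_normalize R d)).
  exact: (measurableT_comp (mh k) (@measurable_enorm _ _)).
- by move=> k z _; rewrite lee_fin mulr_ge0.
apply: eq_eseriesr => k _; rewrite polar_integral_unif//.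
have -> : (\int[leb]_r ((0 < r)%R%:R * (r ^+ d * h k r))%:E =
    (peak ^+ d.+1 * expR (- (s ^+ 2 / 2)) * (s ^+ k / k`!%:R))%:E * (pc_int d k s)%:E)%E.
  rewrite -pc_integral// -ge0_integralZl; last 4 first.
  - exact: measurableT.
  - by apply/measurable_EFinP; exact: measurable_pc_fun.
  - by move=> r _; rewrite lee_fin; exact: pc_fun_ge0.
  - by rewrite lee_fin.
  apply: eq_integral => r _; rewrite -EFinM; congr EFin; rewrite /h /pc_fun.
  have [r0|r0] := ltP 0 r; last by rewrite !mul0r mulr0.
  by rewrite (ltW r0) !mul1r exprD; ring.
rewrite sbetaE /g.
under [in RHS]eq_integral do rewrite EFinM.
rewrite ge0_integralZl; last 4 first.
- exact: mA.
- by apply/measurable_funTS/measurable_EFinP; exact: measurable_funX.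
- by move=> x _; rewrite lee_fin exprn_ge0.
- by rewrite lee_fin ltW.
have -> : (\int[U]_x (f k x)%:E = \int[U]_(x in A) ((1 + u x) ^+ k)%:E)%E.
  rewrite [RHS](integral_mkbool _ (b := fun x => x \in A)); last first.
    by move=> x; split => [/mem_set|/set_mem].
  by apply: eq_integral => x _; rewrite /f indicE.
rewrite [RHS]muleA -!EFinM; congr (_%:E * _)%E.
rewrite dpc_sbeta_const// -/s s2.
have g1 : gaussR d != 0 :> R by rewrite gt_eqF ?gaussR_gt0.
have p1 : peak ^+ d.+1 != 0 by rewrite expf_neq0// peak_neq0.
have k1 : k`!%:R != 0 :> R by rewrite pnatr_eq0 -lt0n fact_gt0.
move: (peak ^+ _) (gaussR d) (k`!%:R) p1 g1 k1 => a b e a0 b0 e0.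
by move: (expR _) (s ^+ k) (pc_int d k s) => x y t; field; rewrite a0 b0 e0.
Qed.

(** The sign is read off the product with the positive constant [c k], whose factors are visibly
    nonnegative. *)
Lemma dpc_ge0 (rho : R) k : 0 < rho -> 0 <= dpc (lambda_of d + 1) rho k.
Proof.
move=> rho0; rewrite -(pmulr_lge0 _ (c0 k)) dpc_sbeta_const//.
apply: mulr_ge0; last first.
  rewrite divr_ge0 ?(ltW (gaussR_gt0 _))//.
  apply: Rintegral_ge0 => r; rewrite /= in_itv/= andbT => r0.
  by rewrite mulr_ge0 ?expR_ge0// exprn_ge0// ltW.
rewrite mulr_ge0 ?expR_ge0// mulr_ge0 ?invr_ge0// exprn_ge0// mulr_ge0 ?sqrtr_ge0//.
exact: ltW.
Qed.

(** At a single location [eta] the integrals of (1 - u)^j under [P] already determine the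
    weights. *)
Lemma sbeta_mixture_unique (P : probability (sphere R d) R) (w v : nat -> R) :
  is_pmf w -> is_pmf v ->
  (forall A, measurable A ->
     P A = \sum_(0 <= n <oo) (w n)%:E * sbeta eta 1 (n%:R + 1)%R A)%E ->
  (forall A, measurable A ->
     P A = \sum_(0 <= n <oo) (v n)%:E * sbeta eta 1 (n%:R + 1)%R A)%E ->
  w = v.
Proof.
move=> pw pv Pw Pv.
pose q j n := c n * sphere_beta eta j n.
have qE j n : (\int[U]_x (((1 - u x) ^+ j)%:E * (g n x)%:E) = (q j n)%:E)%E.
  under eq_integral do rewrite -EFinM /g mulrCA EFinM.
  rewrite ge0_integralZl; last 4 first.
  - exact: measurableT.
  - by apply/measurable_EFinP; apply: measurable_funM; exact: measurable_funX.
  - by move=> x _; rewrite lee_fin mulr_ge0// exprn_ge0.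
  - by rewrite lee_fin ltW.
  by rewrite integral_sphere_beta.
have H (x : nat -> R) : is_pmf x -> (forall A, measurable A ->
     P A = \sum_(0 <= n <oo) (x n)%:E * sbeta eta 1 (n%:R + 1)%R A)%E ->
   forall j, (\int[P]_y ((1 - u y) ^+ j)%:E = \sum_(0 <= n <oo) (x n * q j n)%:E)%E.
  move=> [x0 _] Px j.
  rewrite (@ge0_integral_mixture _ _ _ P (fun n => sbeta eta 1 (n%:R + 1)) x U g); last 8 first.
  - exact: is_probability_sbeta.
  - exact: x0.
  - exact: Px.
  - exact: mg.
  - exact: g0.
  - by move=> n A _; exact: sbetaE.
  - by apply/measurable_EFinP; exact: measurable_funX.
  - by move=> y; rewrite lee_fin exprn_ge0.
  by apply: eq_eseriesr => n _; rewrite qE.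
apply: (@mixture_weights_unique R d q) => //.
- by move=> j n; rewrite mulr_gt0// sphere_beta_gt0.
(* Here q(j, n) = B(j, n) / B(0, n); dividing the recursion at j by the one at 0 cancels the factor
   2n + d. *)
- move=> j n; rewrite /q.
  have B1 : sphere_beta eta 0 n != 0 by rewrite gt_eqF// sphere_beta_gt0.
  have B2 : sphere_beta eta 0 n.+1 != 0 by rewrite gt_eqF// sphere_beta_gt0.
  have c1 : c n = (sphere_beta eta 0 n)^-1.
    by rewrite -[RHS]mul1r -(sbeta_const_beta eta n d0) mulfK.
  have c2 : c n.+1 = (sphere_beta eta 0 n.+1)^-1.
    by rewrite -[RHS]mul1r -(sbeta_const_beta eta n.+1 d0) mulfK.
  have := sphere_beta_rec eta 0 n; rewrite addn0 => E1.
  rewrite mulrCA sphere_beta_rec c1 c2.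
  have nd : (2 * n + d)%:R != 0 :> R.
    by rewrite pnatr_eq0 addn_eq0 negb_and -[d == 0]leqn0 -ltnNge d0 orbT.
  have -> : (n + d)%:R = (2 * n + d)%:R * sphere_beta eta 0 n / sphere_beta eta 0 n.+1.
    by rewrite -E1 mulfK.
  move: (sphere_beta eta 0 n) (sphere_beta eta 0 n.+1) B1 B2 => a b a0 b0.
  by move: ((2 * n + d)%:R) => e; field; rewrite a0 b0.
- by move=> j; rewrite -H// -H.
Qed.

End AngularGaussian.

Theorem theorem5 (R : realType) (d : nat) (hd : (1 <= d)%N) :
  let AG (eta : sphere R d) (rho : {posnum R}) :=
    angular_gaussian eta rho%:num in
  let base (n : nat) (eta : sphere R d) := sbeta eta 1 (n%:R + 1) in
  (exists! w : {posnum R} -> nat -> R,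
     discrete_mixture_representation AG base w) /\
  discrete_mixture_representation AG base
    (fun rho n => dpc (lambda_of d + 1) rho%:num n).
Proof.
move=> AG base.
have rep : discrete_mixture_representation AG base
    (fun rho n => dpc (lambda_of d + 1) rho%:num n).
  split.
  - by move=> n eta; exact: is_probability_sbeta.
  - move=> rho; split; first by move=> n; exact: dpc_ge0.
    (* The weights sum to 1 because the series, evaluated on the whole sphere, has components of
       mass 1. *)
    rewrite -(@probability_setT _ _ _ (AG point rho)).
    rewrite [RHS](angular_gaussian_series point hd _ measurableT)//.
    apply: eq_eseriesr => n _.
    have [P PE] := is_probability_sbeta (point : sphere R d) hd n.
    by rewrite PE// [X in (_ * X)%E]probability_setT mule1.
  - by move=> eta rho A mA; exact: angular_gaussian_series.
split; last exact: rep.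
exists (fun rho n => dpc (lambda_of d + 1) rho%:num n); split; first exact: rep.
move=> w [_ pw wE]; case: rep => _ pv vE.
apply/funext => rho.
(* The weights depend on [rho] alone, so comparing at one location is enough. *)
exact: (sbeta_mixture_unique hd (pv rho) (pw rho) (vE point rho) (wE point rho)).
Qed.
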